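(* Let $G$ be a connected semisimple real Lie group with finite center and Lie algebra $\mathfrak{g}$ of right invariant vector fields. Let $\mathcal{X}_0=\mathcal{X},\mathcal{X}_1,\ldots,\mathcal{X}_m$ be linear vector fields on $G$ with $[\mathcal{X}_i,\mathcal{X}_j]=0$ for all $i,j$, and let $X_0=X,X_1,\ldots,X_m\in\mathfrak{g}$ satisfy $\mathcal{X}_i=X_i+dI X_i$ and $[X_i,X_j]=0$ for all $i,j=0,\ldots,m$. Let $Y,Y_1,\ldots,Y_m\in\mathfrak{g}$ and consider, with piecewise constant admissible controls taking values in $U\subset\mathbb{R}^m$, the affine system $$\Sigma_A:\ \frac{dg}{dt}=(\mathcal{X}+Y)(g)+\sum_{j=1}^{m}u_j(\mathcal{X}_j+Y_j)(g)$$ and the right invariant system $$\Sigma_I:\ \frac{dg}{dt}=(X+Y)(g)+\sum_{j=1}^{m}u_j(X_j+Y_j)(g).$$ Suppose that $\Sigma_I$ satisfies the rank condition and that $\Sigma_A$ is controllable. Then the following assertions are equivalent: (i) for every (constant) control $u=(u_1,\ldots,u_m)\in U$ and every $t\in\mathbb{R}$, $\exp\left(t\left(X_0+\sum_{i=1}^m u_iX_i\right)\right)\in\mathcal{S}$; (ii) $\Sigma_I$ is controllable.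
   Context: A vector field on $G$ is called linear if its flow is a one-parameter group of automorphisms of $G$. Let $I(g)=g^{-1}$; $dI X_i$ denotes the left invariant vector field $I_*X_i$ induced by $X_i$. The relation $\mathcal{X}_i=X_i+dI X_i$ is equivalent to the flow of $\mathcal{X}_i$ being $g\mapsto\exp(tX_i)\,g\,\exp(-tX_i)$; such $X_i$ exist since every derivation of a semisimple Lie algebra is inner. The reachable set of a control system from $g$ is the set of all points reached at some time $t>0$ by solutions starting at $g$ under admissible controls; $\mathcal{S}$ denotes the reachable set of $\Sigma_I$ from the identity $e$. A system is controllable if the reachable set from every point of $G$ is all of $G$. The rank condition for $\Sigma_I$ means that the Lie algebra generated by the vector fields $X+Y+\sum_{j=1}^m u_j(X_j+Y_j)$, $u\in U$, is all of $\mathfrak{g}$. *)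

(* Defs.v *)
From HB Require Import structures.
From mathcomp Require Import all_boot all_order all_algebra.
From mathcomp Require Import all_classical all_reals all_analysis.

Set Implicit Arguments.
Unset Strict Implicit.
Unset Printing Implicit Defensive.

Import Order.TTheory GRing.Theory Num.Theory.
Import numFieldNormedType.Exports.

Local Open Scope classical_set_scope.
Local Open Scope ring_scope.

Section Smoothness.
Context {R : realType} {V W : normedModType R}.

(* A is meant to be open and V finite-dimensional: asking every directional
   derivative to be of class C^k then amounts to f being of class C^(k+1). *)
Fixpoint Ck_on (k : nat) (A : set V) (f : V -> W) {struct k} : Prop :=
  (forall x, A x -> {for x, continuous f}) /\
  if k is k'.+1 then
    (forall x v, A x -> derivable f x v) /\
    (forall v, Ck_on k' A (fun x => 'D_v f x))
  else True.

Definition smooth_on (A : set V) (f : V -> W) := forall k, Ck_on k A f.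

Definition smooth_at (f : V -> W) (x : V) :=
  exists2 A, open_nbhs x A & smooth_on A f.

End Smoothness.

(* Both maps are total; only coord on dom and icoord on coord @` dom matter. *)
Record chart (R : realType) (n : nat) (M : topologicalType) := Chart {
  dom : set M;
  coord : M -> 'rV[R]_n;
  icoord : 'rV[R]_n -> M;
  dom_open : open dom;
  codom_open : open (coord @` dom);
  coordK : forall x, dom x -> icoord (coord x) = x;
  coord_continuous : forall x, dom x -> {for x, continuous coord};
  icoord_continuous :
    forall y, (coord @` dom) y -> {for y, continuous icoord} }.

HB.mixin Record isLieGroup (R : realType) (n : nat) G
    of Topological G & Group G := {
  lie_hausdorff : hausdorff_space G;
  lie_second_countable : @second_countable G;
  atlas : set (chart R n G);
  atlas_cover : forall x : G, exists2 c, atlas c & dom c x;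
  atlas_compatible : forall c d, atlas c -> atlas d ->
    smooth_on (coord c @` (dom c `&` dom d)) (coord d \o icoord c);
  mulg_continuous : continuous (fun p : G * G => (p.1 * p.2)%g);
  invg_continuous : continuous (fun x : G => x^-1%g);
  mulg_smooth : forall (x y : G) c d e, atlas c -> atlas d -> atlas e ->
    dom c x -> dom d y -> dom e (x * y)%g ->
    smooth_at (fun p : 'rV[R]_n * 'rV[R]_n =>
                 coord e (icoord c p.1 * icoord d p.2)%g)
              (coord c x, coord d y);
  invg_smooth : forall (x : G) c d, atlas c -> atlas d ->
    dom c x -> dom d (x^-1)%g ->
    smooth_at (fun p : 'rV[R]_n => coord d ((icoord c p)^-1)%g) (coord c x)
}.

#[short(type="lieGroupType")]
HB.structure Definition LieGroup (R : realType) (n : nat) :=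
  { G of Topological G & Group G & isLieGroup R n G }.

Section LieGroupTheory.
Context {R : realType} {n : nat} {G : lieGroupType R n}.

(* f need only be smooth on some neighbourhood of x. *)
Definition smooth_fun_at (f : G -> R) (x : G) :=
  forall c : chart R n G, atlas c -> dom c x ->
    smooth_at (f \o icoord c) (coord c x).

Definition smooth_map (phi : G -> G) :=
  continuous phi /\
  forall (x : G) (c d : chart R n G), atlas c -> atlas d ->
    dom c x -> dom d (phi x) ->
    smooth_at (coord d \o phi \o icoord c) (coord c x).

Definition lie_automorphism (phi : G -> G) :=
  {morph phi : x y / (x * y)%g} /\
  exists psi, [/\ cancel phi psi, cancel psi phi,
                  smooth_map phi & smooth_map psi].

(* Vector fields are represented by their action on functions: X f x is the
   derivative of f at x along X, for f smooth near x.  The first clause pins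
   down the irrelevant values, so that equality of operators is equality of
   vector fields.  The second one says that X is \sum_i a_i \partial_i in each
   chart, with smooth coefficients a_i. *)
Definition vector_field (X : (G -> R) -> (G -> R)) :=
  (forall f x, ~ smooth_fun_at f x -> X f x = 0) /\
  (forall c : chart R n G, atlas c ->
    exists2 a : 'rV[R]_n -> 'rV[R]_n, smooth_on (coord c @` dom c) a &
      forall f x, dom c x -> smooth_fun_at f x ->
        X f x = 'D_(a (coord c x)) (f \o icoord c) (coord c x)).

Definition bracket (X Y : (G -> R) -> (G -> R)) : (G -> R) -> (G -> R) :=
  fun f x => if `[< smooth_fun_at f x >] then X (Y f) x - Y (X f) x else 0.

Definition rinv_lie_algebra : set ((G -> R) -> (G -> R)) :=
  [set X | vector_field X /\
           forall g f x, X (fun y => f (y * g)%g) x = X f (x * g)%g].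

(* The pushforward I_* X under the inversion I of G. *)
Definition dI (X : (G -> R) -> (G -> R)) : (G -> R) -> (G -> R) :=
  fun f x => X (fun y => f (y^-1)%g) (x^-1)%g.

Definition integral_curve (X : (G -> R) -> (G -> R)) (gamma : R -> G) :=
  continuous gamma /\
  forall t f, smooth_fun_at f (gamma t) ->
    is_derive t (1 : R) (f \o gamma) (X f (gamma t)).

Definition lie_exp (X : (G -> R) -> (G -> R)) : G :=
  xget 1%g [set g | exists gamma,
    [/\ integral_curve X gamma, gamma 0 = 1%g & gamma 1 = g]].

Definition linear_vector_field (X : (G -> R) -> (G -> R)) :=
  vector_field X /\
  exists phi : R -> G -> G,
    [/\ forall g, phi 0 g = g,
        forall s t g, phi (s + t) g = phi s (phi t g),
        forall g, integral_curve X (fun t => phi t g) &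
        forall t, lie_automorphism (phi t)].

Definition subspace (L : set ((G -> R) -> (G -> R))) :=
  L 0 /\ forall (a : R) X Y, L X -> L Y -> L (a *: X + Y).

Definition lie_subalgebra (L : set ((G -> R) -> (G -> R))) :=
  subspace L /\ forall X Y, L X -> L Y -> L (bracket X Y).

Definition generated_lie_algebra (A : set ((G -> R) -> (G -> R))) :=
  smallest lie_subalgebra A.

Definition lie_ideal (L I : set ((G -> R) -> (G -> R))) :=
  [/\ I `<=` L, subspace I & forall X Y, L X -> I Y -> I (bracket X Y)].

Definition derived_algebra (L : set ((G -> R) -> (G -> R))) :=
  smallest subspace [set bracket X Y | X in L & Y in L].

Definition solvable_lie (L : set ((G -> R) -> (G -> R))) :=
  exists k : nat, iter k derived_algebra L `<=` [set 0].

Definition semisimple_lie (L : set ((G -> R) -> (G -> R))) :=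
  forall I, lie_ideal L I -> solvable_lie I -> I `<=` [set 0].

Section ControlSystems.
Context {m : nat}.

(* The field Z_0 + \sum_(1 <= j <= m) u_j Z_j. *)
Definition affine_field (Z : 'I_m.+1 -> (G -> R) -> (G -> R)) (u : 'rV[R]_m) :
    (G -> R) -> (G -> R) :=
  Z ord0 + \sum_(j < m) u ord0 j *: Z (lift ord0 j).

(* s is a finite list of times containing all the discontinuities of u. *)
Definition admissible_control (U : set 'rV[R]_m) (T : R) (s : seq R)
    (u : R -> 'rV[R]_m) :=
  (forall t, 0 <= t <= T -> U (u t)) /\
  (forall a b, 0 < a -> a <= b -> b < T ->
    (forall t, a <= t <= b -> t \notin s) -> u a = u b).

Definition solution (F : 'rV[R]_m -> (G -> R) -> (G -> R)) (T : R) (s : seq R)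
    (u : R -> 'rV[R]_m) (gamma : R -> G) :=
  {within `[0, T], continuous gamma} /\
  forall t f, 0 < t < T -> t \notin s -> smooth_fun_at f (gamma t) ->
    is_derive t (1 : R) (f \o gamma) (F (u t) f (gamma t)).

Definition reachable (F : 'rV[R]_m -> (G -> R) -> (G -> R)) (U : set 'rV[R]_m)
    (g : G) : set G :=
  [set h | exists (T : R) (s : seq R) (u : R -> 'rV[R]_m) (gamma : R -> G),
    [/\ 0 < T, admissible_control U T s u, solution F T s u gamma,
        gamma 0 = g & gamma T = h]].

Definition controllable (F : 'rV[R]_m -> (G -> R) -> (G -> R))
    (U : set 'rV[R]_m) :=
  forall g, reachable F U g = setT.

Definition rank_condition (F : 'rV[R]_m -> (G -> R) -> (G -> R))
    (U : set 'rV[R]_m) :=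
  generated_lie_algebra [set F u | u in U] = rinv_lie_algebra.

End ControlSystems.

End LieGroupTheory.

Arguments rinv_lie_algebra {R n} G.

(* Main.v *)
Require Import Defs.
From HB Require Import structures.
From mathcomp Require Import all_boot all_order all_algebra.
From mathcomp Require Import all_classical all_reals all_analysis.
From mathcomp Require Import lra.
Import Order.TTheory GRing.Theory Num.Theory.
Import numFieldNormedType.Exports.
Local Open Scope classical_set_scope.
Local Open Scope ring_scope.

(** Write S for the set reachable from 1 under Sigma_I and X_u for the field
    X_0 + \sum_j u_j X_j.  Since X_u is right invariant, dI X_u is left
    invariant and minus it generates right multiplication by exp(t X_u); so
    while the control is constantly u a trajectory gamma of Sigma_A reads
      gamma(t) = exp(t (X_u + Y_u)) gamma(0) exp(- t X_u),
    that is, it is a trajectory of Sigma_I corrected on the right by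
    exponentials of the fields X_u.  If those exponentials all lie in S then,
    S being a semigroup, every point that Sigma_A reaches from 1 lies in S.
    Controllability of Sigma_A thus gives S = G, and by right invariance
    Sigma_I then reaches S g = G from every g.  The converse implication is
    immediate.

    The factorization is established without solving Sigma_I: on an interval
    [a, b] where the control is u, let zeta be any integral curve of
    (a - b) X_u with zeta(0) = 1 and zeta(1) = lie_exp ((a - b) X_u), and run it
    backwards as kappa(t) = zeta((b - t) / (b - a)), an integral curve of X_u.
    By the product rule the left invariant part of the velocity of gamma cancels
    in gamma kappa (tangent_at_conj), which is therefore a trajectory of Sigma_I;
    it leads from gamma(a) lie_exp ((a - b) X_u) to gamma(b)
    (constant_control_step).  An induction on the number of switching times
    concludes (affine_reachable_sub).

    Such a zeta has to be shown to exist, since lie_exp is defined by choice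
    among integral curves on the whole line.  The coefficients of a right
    invariant field in a chart at 1 are smooth, so Picard iteration yields a
    local integral curve (local_ode_solution), and right translates of one such
    curve are pasted together into a curve on the line (integral_curve_exists).

    The rest is calculus.  Smoothness is expressed through iterated directional
    derivatives, so the chain rule rests on C1_differentiable (continuous
    directional derivatives imply differentiability on row vectors) and on the
    stability of smoothness under composition (Ck_on_comp).  Hence translations
    and inversion preserve smooth functions, and products of curves obey the
    Leibniz rule (has_velocityM). *)

Set Implicit Arguments.
Unset Strict Implicit.

(* The name coord is also that of the coordinates of a vector in a basis. *)
Local Notation coord := Defs.coord.

(** * Differentiability from continuous directional derivatives *)

Lemma mean_value_ineq {R : realType} (f : R -> R) (a b M : R) :
  (forall t, Num.min a b <= t <= Num.max a b ->
     derivable f t 1 /\ `|'D_1 f t| <= M) ->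
  `|f b - f a| <= M * `|b - a|.
Proof.
wlog ab : a b / a <= b => [hw|] fM.
  have [ab|/ltW ba] := leP a b; first exact: hw.
  rewrite distrC (distrC b) hw// => t; rewrite minC maxC; exact: fM.
move: fM; rewrite (min_idPl ab) (max_idPr ab) => fM.
have [x xab||c cab ->] := @MVT_segment R f ('D_1 f) a b ab.
- apply: derivableP; apply: (fM _ _).1.
  by move: xab; rewrite in_itv/= => /andP[/ltW -> /ltW ->].
- apply: derivable_within_continuous => s.
  by rewrite in_itv /= => /fM[].
- by rewrite normrM ler_wpM2r// (fM _ _).2//; move: cab; rewrite in_itv.
Qed.

Lemma mx_ballE {R : realType} {n : nat} (x y : 'rV[R]_n) (r : R) :
  0 < r -> ball x r y <-> forall i, `|x ord0 i - y ord0 i| < r.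
Proof.
move=> r0; split=> [[_ xy] i|xy].
  exact: xy.
by split=> // i j; rewrite (ord1 i); exact: xy.
Qed.

Lemma normr_row_le {R : realType} {n : nat} (x : 'rV[R]_n) i :
  `|x ord0 i| <= `|x|.
Proof.
rewrite [leRHS]/Num.Def.normr/= mx_normrE.
exact: (le_bigmax _ (fun ij => `|x ij.1 ij.2|) (ord0, i)).
Qed.

Lemma normr_row_le_bound {R : realType} {n : nat} (x : 'rV[R]_n) (M : R) :
  0 <= M -> (forall i, `|x ord0 i| <= M) -> `|x| <= M.
Proof.
move=> M0 xM; rewrite [leLHS]/Num.Def.normr/= mx_normrE bigmax_le// => -[i j] _ /=.
by rewrite (ord1 i).
Qed.

(** Balls of the sup norm are boxes: y is joined to z inside the ball by changing
    one coordinate at a time, and the mean value inequality applies to each of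
    these n moves. *)
Lemma box_lipschitz {R : realType} {n : nat} (f : 'rV[R]_n -> R)
    (x : 'rV[R]_n) (r M : R) :
  (forall i y, ball x r y -> derivable f y (delta_mx ord0 i) /\
     `|'D_(delta_mx ord0 i) f y| <= M) ->
  forall y z, ball x r y -> ball x r z ->
  `|f z - f y| <= n%:R * M * `|z - y|.
Proof.
move=> fM y z xy xz.
have r0 : 0 < r by case: xy.
(* w k agrees with z on the first k coordinates and with y on the others. *)
pose w k : 'rV[R]_n := \row_i if (i < k)%N then z ord0 i else y ord0 i.
have w0 : w 0%N = y by apply/rowP => i; rewrite mxE.
have wn : w n = z by apply/rowP => i; rewrite mxE ltn_ord.
suff H k : (k <= n)%N -> `|f (w k) - f y| <= k%:R * M * `|z - y|.
  by have := H n (leqnn n); rewrite wn.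
elim: k => [_|k IH kn]; first by rewrite w0 subrr normr0 !mul0r.
rewrite -(subrKA (f (w k))) (le_trans (ler_normD _ _))//.
rewrite -natr1 2!mulrDl addrC lerD ?IH ?(ltnW kn)// mul1r.
pose i := Ordinal kn.
pose p (t : R) := w k + (t - y ord0 i) *: delta_mx ord0 i.
have pE t j : p t ord0 j = if j == i then t else w k ord0 j.
  rewrite !mxE eqxx /=; case: eqVneq => [->|ji].
    by rewrite ltnn mulr1 addrC subrK.
  by rewrite mulr0 addr0.
have -> : f (w k) = f (p (y ord0 i)) by rewrite /p subrr scale0r addr0.
have -> : f (w k.+1) = f (p (z ord0 i)).
  congr f; apply/rowP => j; rewrite pE !mxE ltnS leq_eqVlt.
  by rewrite -[j == i]/((j : nat) == k); case: (eqVneq (j : nat) k) => [jk|//];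
    congr (z _ _); apply: val_inj.
have pball t : Num.min (y ord0 i) (z ord0 i) <= t <= Num.max (y ord0 i) (z ord0 i) ->
    ball x r (p t).
  move=> ht; apply/mx_ballE => // j; rewrite pE; case: eqVneq => [->|_].
    have := (mx_ballE _ _ r0).1 xy i; have := (mx_ballE _ _ r0).1 xz i.
    rewrite !ltr_distlC => /andP[z1 z2] /andP[y1 y2].
    move: ht; case: (leP (y ord0 i) (z ord0 i)) => _ /andP[t1 t2]; apply/andP; split; lra.
  by rewrite mxE; case: ifP => _;
    [exact: (mx_ballE _ _ r0).1 xz j|exact: (mx_ballE _ _ r0).1 xy j].
have M0 : 0 <= M by apply: le_trans (fM i y xy).2.
apply: (@le_trans _ _ (M * `|z ord0 i - y ord0 i|)); last first.
  by rewrite ler_wpM2l//; have := normr_row_le (z - y) i; rewrite !mxE.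
apply: (@mean_value_ineq R (f \o p)) => t ht.
have [fd fb] := fM i _ (pball t ht).
suff eqf : (fun h : R => h^-1 *: ((f \o p \o shift t) (h *: 1) - (f \o p) t)) =
    (fun h : R => h^-1 *: ((f \o shift (p t)) (h *: delta_mx ord0 i) - f (p t))).
  by rewrite /derivable /derive eqf; split.
apply/funext => h /=; congr (_ *: (f _ - _)).
by apply/rowP => j; rewrite pE !mxE eqxx /=; case: eqVneq => [->|_];
  rewrite ?ltnn ?[h%:A]mulr1 ?mulr1 ?mulr0; lra.
Qed.

(** Once the linear map L with the same partial derivatives at x is subtracted,
    the partial derivatives are arbitrarily small near x, so that box_lipschitz
    makes the increment negligible: the differential of f - L at x is 0. *)
Lemma C1_differentiable {R : realType} {n : nat} (f : 'rV[R]_n -> R) (A : set 'rV[R]_n)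
    (x : 'rV[R]_n) :
  open_nbhs x A ->
  (forall y v, A y -> derivable f y v) ->
  (forall v, {for x, continuous ('D_v f)}) ->
  differentiable f x.
Proof.
move=> [oA Ax] fd fc.
pose e (i : 'I_n) : 'rV[R]_n := delta_mx ord0 i.
pose L := \sum_(i < n) ('D_(e i) f x *: (fun y : 'rV[R]_n => y ord0 i : R)).
have Lv y i : is_derive y (e i) L ('D_(e i) f x).
  have -> : 'D_(e i) f x = \sum_(j < n) 'D_(e j) f x *: ((i == j)%:R : R).
    rewrite (bigD1 i) //= eqxx [_ *: _]mulr1 big1 ?addr0// => j ji.
    by rewrite eq_sym (negPf ji) scaler0.
  apply: is_derive_sum => j; apply: is_deriveZ.
  have := derivableP (@diff_derivable _ _ _ _ y (e i) (@differentiable_coord R _ _ y ord0 j)).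
  rewrite deriveE; last exact: differentiable_coord.
  have @g : {linear 'rV[R]_n -> R}.
    by exists (fun N : 'rV[R]_n => N ord0 j); do 2![eexists]; do ?[constructor];
     rewrite ?mxE// => ? *; rewrite ?mxE//; move=> ?; rewrite !mxE.
  rewrite (_ : (fun _ => _) = g) // diff_lin; last exact: coord_continuous.
  by move=> H; apply: is_derive_eq H _; rewrite /= mxE eqxx /= eq_sym.
have dL y : differentiable L y.
  by apply: differentiable_sum => i; apply: differentiableZ; exact: differentiable_coord.
pose g : 'rV[R]_n -> R := f - L.
suff dg : differentiable g x.
  have -> : f = g + L by rewrite /g subrK.
  exact: differentiableD.
have gi y i : A y -> is_derive y (e i) g ('D_(e i) f y - 'D_(e i) f x).
  by move=> Ay; apply: is_deriveB; apply: derivableP; exact: fd.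
have o0 : g \o shift x = cst (g x) + (\0 : {linear 'rV[R]_n -> R}) +o_ (0 : 'rV[R]_n) id.
  apply/eqaddoP => _/posnumP[eps].
  pose M := eps%:num / n.+1%:R.
  have M0 : 0 < M by rewrite divr_gt0.
  have : \forall y \near x, A y /\ forall i : 'I_n, `|'D_(e i) f y - 'D_(e i) f x| <= M.
    apply: filterI; first by apply: open_nbhs_nbhs.
    apply: (@filter_forall _ _ (fun i y => `|'D_(e i) f y - 'D_(e i) f x| <= M) (nbhs x)) => i.
    have /cvgrPdist_le/(_ _ M0) := fc (e i).
    by apply: filterS => y; rewrite distrC.
  move=> /nbhs_ballP[r r0 xr].
  have lip := @box_lipschitz R n g x r M.
  have : \forall h \near (0 : 'rV[R]_n), `|h| < r by exact: nbhs0_lt.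
  apply: filterS => h hr; rewrite /= !fctE !addr0.
  have hx : ball x r (h + x).
    rewrite -ball_normE/= opprD addrCA subrr addr0 normrN.
    exact: hr.
  have -> : g (h + x) - g x = g (h + x) - g x by [].
  apply: (le_trans (lip _ x (h + x) _ hx)).
  - move=> i y /xr[Ay yM]; have [gd gv] := gi y i Ay.
    by split=> //; rewrite gv.
  - exact: ballxx.
  - rewrite addrK ler_wpM2r// /M mulrCA ler_piMr// ler_pdivrMr// mul1r ler_nat.
    exact: leqnSn.
apply/diff_locallyP.
have c0 : continuous (\0 : {linear 'rV[R]_n -> R}) by move=> y; exact: cst_continuous.
by have d0 := diff_unique c0 o0; rewrite d0.
Qed.

(** * Calculus of C^k functions *)

Section CkCalculus.
Context {R : realType}.
Implicit Types V W : normedModType R.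

(** Differentiability of the outer map cannot be weakened to the existence of its
    directional derivatives: the inner map moves along a curve, not a line. *)
Lemma is_derive_comp V V' W (f : V -> V') (g : V' -> W) x v df :
  is_derive x v f df -> differentiable g (f x) ->
  is_derive x v (g \o f) ('d g (f x) df).
Proof.
move=> [fd <-] gd.
pose l (h : R) := f (h *: v + x).
have l0 : l 0 = f x by rewrite /l scale0r add0r.
have ld : differentiable l 0 by apply/derivable1_diffP; apply/(derivable1P f x v).
have gd0 : differentiable g (l 0) by rewrite l0.
have c : differentiable (g \o l) 0 by exact: differentiable_comp.
split; first by apply/derivable1P; apply/derivable1_diffP.
have e (U : normedModType R) (k : V -> U) : 'D_v k x = 'D_1 (fun h : R => k (h *: v + x)) 0.
  rewrite /derive; set d := (fun _ : R => _ *: _); set d' := (fun _ : R => _ *: _).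
  suff -> : d = d' by []; apply/funext => h; rewrite /d /d' /=.
  by rewrite addr0 scale0r add0r [h%:A]mulr1.
by rewrite !e -/l -/(g \o l) !deriveE// diff_comp//= l0.
Qed.

Lemma eq_Ck_on V W k (A : set V) (f g : V -> W) : open A ->
  (forall x, A x -> f x = g x) -> Ck_on k A f -> Ck_on k A g.
Proof.
move=> oA; elim: k f g => [|k IH] f g fg.
  move=> [fc _]; split=> // x Ax.
  have nfg : \near x, f x = g x.
    by apply: (@filterS _ (nbhs x) _ A) (open_nbhs_nbhs (conj oA Ax)) => y; exact: fg.
  rewrite /prop_for /continuous_at -fg//; apply: cvg_trans (fc x Ax).
  exact: near_eq_cvg.
have nfg x : A x -> \near x, f x = g x.
  by move=> Ax; apply: filterS (open_nbhs_nbhs (conj oA Ax)) => y; exact: fg.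
move=> [fc [fd fD]]; split=> [x Ax|].
  rewrite /prop_for /continuous_at -fg//; apply: cvg_trans (fc x Ax).
  by apply: near_eq_cvg; exact: nfg.
split=> [x v Ax|v]; first by apply: near_eq_derivable (nfg x Ax) (fd x v Ax).
apply: IH (fD v) => x Ax.
by apply: near_eq_derive; exact: nfg.
Qed.

Lemma sub_Ck_on V W k (A B : set V) (f : V -> W) :
  B `<=` A -> Ck_on k A f -> Ck_on k B f.
Proof.
move=> BA; elim: k f => [|k IH] f [fc fd]; split=> //.
- by move=> x /BA; exact: fc.
- by move=> x /BA; exact: fc.
- by case: fd => fd fD; split=> [x v /BA|v]; [exact: fd|exact: (IH _ (fD v))].
Qed.

Lemma Ck_onS V W k (A : set V) (f : V -> W) : Ck_on k.+1 A f -> Ck_on k A f.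
Proof.
elim: k f => [|k IH] f [fc [fd fD]]; split=> //.
by split=> // v; exact: (IH _ (fD v)).
Qed.

Lemma Ck_on_cst V W k (A : set V) (w : W) : Ck_on k A (fun=> w).
Proof.
elim: k w => [|k IH] w; split=> //; try by move=> x _; exact: cvg_cst.
split=> [x v _|v]; first exact: derivable_cst.
have -> : (fun x : V => 'D_v (fun=> w) x) = (fun=> 0 : W) by apply/funext => x; exact: derive_cst.
exact: IH.
Qed.

Lemma Ck_onD V W k (A : set V) (f g : V -> W) : open A ->
  Ck_on k A f -> Ck_on k A g -> Ck_on k A (f + g).
Proof.
move=> oA; elim: k f g => [|k IH] f g [fc fd] [gc gd].
  by split=> // x Ax; apply: continuousD; [exact: fc|exact: gc].
split=> [x Ax|]; first by apply: continuousD; [exact: fc|exact: gc].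
case: fd gd => [fd fD] [gd gD]; split=> [x v Ax|v].
  by apply: derivableD; [exact: fd|exact: gd].
by apply: eq_Ck_on (IH _ _ (fD v) (gD v)) => // x Ax; rewrite deriveD//;
  [exact: fd|exact: gd].
Qed.

Lemma Ck_onZ V W k (A : set V) (a : R) (f : V -> W) : open A ->
  Ck_on k A f -> Ck_on k A (a *: f).
Proof.
move=> oA; elim: k f => [|k IH] f [fc fd].
  by split=> // x Ax; apply: continuousZl_tmp; exact: fc.
split=> [x Ax|]; first by apply: continuousZl_tmp; exact: fc.
case: fd => [fd fD]; split=> [x v Ax|v].
  by apply: derivableZ; exact: fd.
by apply: eq_Ck_on (IH _ (fD v)) => // x Ax; rewrite deriveZ//; exact: fd.
Qed.

Lemma Ck_onM V k (A : set V) (f g : V -> R) : open A ->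
  Ck_on k A f -> Ck_on k A g -> Ck_on k A (f * g).
Proof.
move=> oA; elim: k f g => [|k IH] f g.
  move=> [fc fd] [gc gd].
  by split=> // x Ax; apply: continuousM; [exact: fc|exact: gc].
move=> fk gk; have [[fc [fd fD]] [gc [gd gD]]] := (fk, gk).
split=> [x Ax|]; first by apply: continuousM; [exact: fc|exact: gc].
split=> [x v Ax|v]; first by apply: derivableM; [exact: fd|exact: gd].
apply: (@eq_Ck_on _ _ _ _ (f * 'D_v g + g * 'D_v f)) => //.
  by move=> x Ax; rewrite deriveM//; [exact: fd|exact: gd].
by apply: Ck_onD => //; [apply: IH _ (gD v)|apply: IH _ (fD v)]; exact: Ck_onS.
Qed.

Lemma Ck_on_sum V W k (A : set V) (n : nat) (f : 'I_n -> V -> W) : open A ->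
  (forall i, Ck_on k A (f i)) -> Ck_on k A (\sum_i f i).
Proof.
move=> oA fk; elim/big_ind: _ => //; first exact: Ck_on_cst.
by move=> g h; exact: Ck_onD.
Qed.

Lemma Ck_on_coord V n k (A : set V) (f : V -> 'rV[R]_n) i : open A ->
  Ck_on k A f -> Ck_on k A (fun x => f x ord0 i).
Proof.
move=> oA; elim: k f => [|k IH] f [fc fd].
  split=> // x Ax.
  exact: (continuous_comp (fc x Ax) (@coord_continuous R _ _ ord0 i (f x))).
split=> [x Ax|].
  exact: (continuous_comp (fc x Ax) (@coord_continuous R _ _ ord0 i (f x))).
case: fd => fd fD; split=> [x v Ax|v].
  by move: (fd x v Ax) => /derivable_mxP.
apply: eq_Ck_on (IH _ (fD v)) => // x Ax.
by rewrite derive_mx ?mxE//; exact: fd.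
Qed.

(** l plays the part of the linear part of the affine map iota. *)
Lemma Ck_on_precomp_affine V V' W k (A : set V') (f : V' -> W) (iota l : V -> V') :
  continuous iota -> (forall (h : R) v x, iota (h *: v + x) = h *: l v + iota x) ->
  Ck_on k A f -> Ck_on k (iota @^-1` A) (f \o iota).
Proof.
move=> ic il; elim: k f => [|k IH] f [fc fd].
  by split=> // x Ax; exact: (continuous_comp (ic x) (fc _ Ax)).
split=> [x Ax|]; first exact: (continuous_comp (ic x) (fc _ Ax)).
case: fd => fd fD.
have e x v : (fun h : R => h^-1 *: (((f \o iota) \o shift x) (h *: v) - (f \o iota) x)) =
    (fun h : R => h^-1 *: ((f \o shift (iota x)) (h *: l v) - f (iota x))).
  by apply/funext => h /=; rewrite il.
split=> [x v Ax|v]; first by rewrite /derivable e; exact: fd.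
have -> : (fun x => 'D_v (f \o iota) x) = ('D_(l v) f) \o iota.
  by apply/funext => x /=; rewrite /derive e.
exact: (IH _ (fD (l v))).
Qed.

Lemma Ck_on_differentiable n k (B : set 'rV[R]_n) (g : 'rV[R]_n -> R) y :
  open B -> Ck_on k.+1 B g -> B y -> differentiable g y.
Proof.
move=> oB [gc [gd gD]] By; apply: (@C1_differentiable _ _ _ B) => //.
by move=> v; case: k {gD} (gD v) => [|k] [/(_ y By)].
Qed.

Lemma diff_rowE n (g : 'rV[R]_n -> R) y w : differentiable g y ->
  'd g y w = \sum_i w ord0 i * 'D_(delta_mx ord0 i) g y.
Proof.
move=> gd; rewrite {1}(row_sum_delta w) linear_sum; apply: eq_bigr => i _.
by rewrite linearZ deriveE.
Qed.

(** By the chain rule a directional derivative of g \o f is the sum of the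
    products of the components of the derivative of f by the partial derivatives
    of g taken along f, so the claim passes from k to k + 1 through products and
    sums.  The values of f lie in a space of row vectors because this is where
    C^1 functions are known to be differentiable. *)
Lemma Ck_on_comp V n k (A : set V) (B : set 'rV[R]_n) (f : V -> 'rV[R]_n)
    (g : 'rV[R]_n -> R) :
  open A -> open B -> (forall x, A x -> B (f x)) ->
  Ck_on k A f -> Ck_on k B g -> Ck_on k A (g \o f).
Proof.
move=> oA oB AB; elim: k g => [|k IH] g.
  move=> [fc _] [gc _]; split=> // x Ax.
  exact: (continuous_comp (fc x Ax) (gc _ (AB x Ax))).
move=> fk gk; have [[fc [fd fD]] [gc [gd gD]]] := (fk, gk).
have H x v : A x -> is_derive x v (g \o f) ('d g (f x) ('D_v f x)).
  move=> Ax; apply: is_derive_comp; first by apply: derivableP; exact: fd.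
  exact: Ck_on_differentiable gk (AB x Ax).
split=> [x Ax|]; first exact: (continuous_comp (fc x Ax) (gc _ (AB x Ax))).
split=> [x v Ax|v]; first by have [] := H x v Ax.
pose F (i : 'I_n) : V -> R := (fun x => ('D_v f x) ord0 i) * ('D_(delta_mx ord0 i) g \o f).
apply: (@eq_Ck_on V R k A (\sum_(i < n) F i)) => //.
  move=> x Ax; have [_ ->] := H x v Ax; rewrite fct_sumE diff_rowE//.
  exact: Ck_on_differentiable gk (AB x Ax).
apply: Ck_on_sum => // i; apply: Ck_onM => //; first exact: (Ck_on_coord i oA (fD v)).
by apply: IH (gD _); exact: Ck_onS.
Qed.

End CkCalculus.

(** * Smooth functions on a Lie group *)

Section SmoothAt.
Context {R : realType}.
Implicit Types V W : normedModType R.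

Lemma near_smooth_at V W (f g : V -> W) x :
  (\near x, f x = g x) -> smooth_at f x -> smooth_at g x.
Proof.
move=> fg [A [oA Ax] fA].
have [B [oB Bx] Bfg] : exists2 B, open_nbhs x B & B `<=` [set y | f y = g y].
  have : nbhs x [set y | f y = g y] by [].
  by rewrite nbhsE.
exists (A `&` B); first by split; [exact: openI|].
move=> k; apply: (@eq_Ck_on _ _ _ _ _ f); first exact: openI.
  by move=> y [_ /Bfg].
by apply: sub_Ck_on (fA k); exact: subIsetl.
Qed.

Lemma smooth_at_comp V n (f : V -> 'rV[R]_n) (g : 'rV[R]_n -> R) x :
  smooth_at f x -> smooth_at g (f x) -> smooth_at (g \o f) x.
Proof.
move=> [A [oA Ax] fA] [B [oB Bfx] gB].
have oAB : open (A `&` f @^-1` B).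
  have /(continuous_inP _ oA) H : {in A, continuous f}.
    by move=> y /set_mem; have [+ _] := fA 0%N; exact.
  exact: H.
exists (A `&` f @^-1` B) => // k.
apply: (Ck_on_comp (B := B)) => //; first by move=> y [].
by apply: sub_Ck_on (fA k); exact: subIsetl.
Qed.

Lemma smooth_at_precomp_affine V V' W (f : V' -> W) (iota l : V -> V') x :
  continuous iota -> (forall (h : R) v x, iota (h *: v + x) = h *: l v + iota x) ->
  smooth_at f (iota x) -> smooth_at (f \o iota) x.
Proof.
move=> ic il [A [oA Ax] fA]; exists (iota @^-1` A).
  by split=> //; apply: open_comp => // y _; exact: ic.
by move=> k; exact: Ck_on_precomp_affine il (fA k).
Qed.

Lemma smooth_at_differentiable n (f : 'rV[R]_n -> R) x :
  smooth_at f x -> differentiable f x.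
Proof. by move=> [A [oA Ax] fA]; exact: Ck_on_differentiable (fA 1%N) Ax. Qed.

Lemma is_derive_row V n (f : V -> 'rV[R]_n) x v (df : 'rV[R]_n) :
  (forall i, is_derive x v (fun y => f y ord0 i) (df ord0 i)) ->
  is_derive x v f df.
Proof.
move=> fd.
have fdv : derivable f x v.
  by apply/derivable_mxP => i j; rewrite (ord1 i); have [] := fd j.
split=> //; rewrite derive_mx//; apply/rowP => i; rewrite mxE.
by have [] := fd i.
Qed.

Lemma is_derive_coord V n (f : V -> 'rV[R]_n) x v (df : 'rV[R]_n) i :
  is_derive x v f df -> is_derive x v (fun y => f y ord0 i) (df ord0 i).
Proof.
move=> [fd <-]; rewrite derive_mx// mxE; apply: derivableP.
by move/derivable_mxP : fd.
Qed.

End SmoothAt.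

Section SmoothFunctions.
Context {R : realType} {n : nat} {G : lieGroupType R n}.
Implicit Types (c d : chart R n G) (f : G -> R).

Lemma icoordK c p : (coord c @` dom c) p -> coord c (icoord c p) = p.
Proof. by move=> [x cx <-]; rewrite coordK. Qed.

Lemma icoord_dom c p : (coord c @` dom c) p -> dom c (icoord c p).
Proof. by move=> [x cx <-]; rewrite coordK. Qed.

(** Overlaps of charts are open in coordinates, hence usable as the
    neighbourhoods required by smooth_at. *)
Lemma open_coord_image c (S : set G) : open S -> open (coord c @` (dom c `&` S)).
Proof.
move=> oS.
have -> : coord c @` (dom c `&` S) = (coord c @` dom c) `&` icoord c @^-1` S.
  apply/seteqP; split=> [_ [x [cx Sx] <-]|p [[x cx <-]]] /=.
    by split; [exists x|rewrite coordK].
  by rewrite coordK// => Sx; exists x.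
have /(continuous_inP _ (@codom_open R n G c)) : {in coord c @` dom c, continuous (icoord c)}.
  by move=> p /set_mem; exact: icoord_continuous.
exact.
Qed.

Lemma smooth_fun_coord c x i : atlas c -> dom c x ->
  smooth_fun_at (fun y => coord c y ord0 i) x.
Proof.
move=> ac cx d ad dx; exists (coord d @` (dom d `&` dom c)).
  by split; [apply: open_coord_image; exact: dom_open|exists x].
move=> k; apply: (Ck_on_coord (f := coord c \o icoord d)).
  by apply: open_coord_image; exact: dom_open.
exact: (atlas_compatible d c).
Qed.

(** The joint smoothness of f (x * y) in both factors is what the Leibniz rule for
    products of curves needs; smoothness along one factor follows from it by
    freezing the other. *)
Lemma smooth_fun_mul f c d x y : atlas c -> atlas d -> dom c x -> dom d y ->
  smooth_fun_at f (x * y)%g ->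
  smooth_at (fun p : 'rV[R]_n * 'rV[R]_n => f (icoord c p.1 * icoord d p.2)%g)
    (coord c x, coord d y).
Proof.
move=> ac ad cx dy fxy; have [e ae exy] := atlas_cover (x * y)%g.
have m := mulg_smooth x y c d e ac ad ae cx dy exy.
pose mu (p : 'rV[R]_n * 'rV[R]_n) := (icoord c p.1 * icoord d p.2)%g.
have mu0 : mu (coord c x, coord d y) = (x * y)%g by rewrite /mu/= !coordK.
have := smooth_at_comp m; rewrite -/(mu _) => /(_ (f \o icoord e)).
rewrite -/(mu (coord c x, coord d y)) mu0 => /(_ (fxy e ae exy)).
apply: near_smooth_at.
have mc : {for (coord c x, coord d y), continuous mu}.
  have cc : icoord c p.1 @[p --> (coord c x, coord d y)] --> icoord c (coord c x).
    apply: (cvg_comp fst (icoord c)); first exact: cvg_fst.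
    by apply: (@icoord_continuous _ _ _ c (coord c x)); exists x.
  have dc : icoord d p.2 @[p --> (coord c x, coord d y)] --> icoord d (coord d y).
    apply: (cvg_comp snd (icoord d)); first exact: cvg_snd.
    by apply: (@icoord_continuous _ _ _ d (coord d y)); exists y.
  have := cvg_comp2 cc dc (mulg_continuous (_, _)).
  exact.
have : nbhs (mu (coord c x, coord d y)) (dom e).
  by rewrite mu0; apply: open_nbhs_nbhs; split=> //; exact: dom_open.
move=> /mc; apply: (@filterS _ (nbhs (coord c x, coord d y)) _ (mu @^-1` dom e)).
by move=> p /= ep; rewrite coordK.
Qed.

Lemma smooth_fun_mulr f x y :
  smooth_fun_at f (x * y)%g -> smooth_fun_at (fun z => f (z * y)%g) x.
Proof.
move=> fxy c ac cx; have [d ad dy] := atlas_cover y.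
have := smooth_fun_mul ac ad cx dy fxy.
set F := (F in smooth_at F _) => Fs.
have -> : (fun z => f (z * y)%g) \o icoord c = F \o (fun p => (p, coord d y)).
  by apply/funext => p; rewrite /F /= coordK.
apply: (@smooth_at_precomp_affine _ _ _ _ _ _ (fun v => (v, 0))) => //.
  by move=> p; exact: (cvg_pair (G := nbhs p) (H := nbhs (coord d y)) cvg_id (cvg_cst _)).
by move=> h v p; apply: injective_projections; rewrite /= ?scaler0 ?add0r.
Qed.

Lemma smooth_fun_mull f x y :
  smooth_fun_at f (x * y)%g -> smooth_fun_at (fun z => f (x * z)%g) y.
Proof.
move=> fxy d ad dy; have [c ac cx] := atlas_cover x.
have := smooth_fun_mul ac ad cx dy fxy.
set F := (F in smooth_at F _) => Fs.
have -> : (fun z => f (x * z)%g) \o icoord d = F \o (fun p => (coord c x, p)).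
  by apply/funext => p; rewrite /F /= coordK.
apply: (@smooth_at_precomp_affine _ _ _ _ _ _ (fun v => (0, v))) => //.
  by move=> p; exact: (cvg_pair (G := nbhs (coord c x)) (H := nbhs p) (cvg_cst _) cvg_id).
by move=> h v p; apply: injective_projections; rewrite /= ?scaler0 ?add0r.
Qed.

Lemma smooth_fun_inv f x :
  smooth_fun_at f (x^-1)%g -> smooth_fun_at (fun z => f (z^-1)%g) x.
Proof.
move=> fx c ac cx; have [d ad dx] := atlas_cover (x^-1)%g.
have m := invg_smooth x c d ac ad cx dx.
have := smooth_at_comp m (g := f \o icoord d).
rewrite coordK// => /(_ (fx d ad dx)).
apply: near_smooth_at.
have ic : {for coord c x, continuous (fun p => (icoord c p)^-1%g)}.
  apply: (@continuous_comp _ _ _ (icoord c) (fun z : G => z^-1%g)).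
    by apply: icoord_continuous; exists x.
  exact: invg_continuous.
have : nbhs ((icoord c (coord c x))^-1)%g (dom d).
  by rewrite coordK//; apply: open_nbhs_nbhs; split=> //; exact: dom_open.
move=> /ic; apply: (@filterS _ (nbhs (coord c x)) _
  ((fun p => (icoord c p)^-1%g) @^-1` dom d)).
by move=> p /= dp; rewrite coordK.
Qed.

End SmoothFunctions.

(** * Velocities of curves *)

Lemma is_derive_affine_map {R : realType} (a b t : R) :
  is_derive t (1 : R) (fun s : R => a * s + b) a.
Proof.
have := is_deriveD (is_deriveZ a (is_derive_id t (1 : R))) (is_derive_cst b t (1 : R)).
by move=> /is_derive_eq; apply; rewrite addr0 [_ *: _]mulr1.
Qed.

Lemma is_derive_affine {R : realType} (f : R -> R) (a b t D : R) :
  is_derive (a * t + b) (1 : R) f D ->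
  is_derive t (1 : R) (fun s => f (a * s + b)) (a * D).
Proof.
move=> [fd fE].
have := is_derive_comp (is_derive_affine_map a b t) ((derivable1_diffP _ _).1 fd).
move=> /is_derive_eq; apply.
rewrite -[X in 'd _ _ X = _](mulr1 a) [LHS]linearZ -deriveE.
  by rewrite fE.
exact: (derivable1_diffP _ _).1.
Qed.

Section Velocity.
Context {R : realType} {n : nat} {G : lieGroupType R n}.
Implicit Types (c d : chart R n G) (f : G -> R) (gamma kappa : R -> G).
Implicit Types (D : (G -> R) -> R).

(** Tangent vectors are represented by their action D on functions, as vector
    fields are. *)
Definition has_velocity gamma (t : R) D :=
  {for t, continuous gamma} /\
  forall f, smooth_fun_at f (gamma t) -> is_derive t (1 : R) (f \o gamma) (D f).

Lemma near_has_velocity gamma kappa t D :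
  (\near t, gamma t = kappa t) -> has_velocity gamma t D -> has_velocity kappa t D.
Proof.
move=> gk [gc gd]; have gkt : gamma t = kappa t by exact: nbhs_singleton gk.
split=> [|f fs].
  rewrite /prop_for /continuous_at -gkt; apply: cvg_trans gc.
  exact: near_eq_cvg.
rewrite -gkt in fs; apply: near_eq_is_derive (gd f fs).
by apply: filterS gk => s /= ->.
Qed.

Lemma eq_has_velocity gamma t D D' :
  (forall f, smooth_fun_at f (gamma t) -> D f = D' f) ->
  has_velocity gamma t D -> has_velocity gamma t D'.
Proof.
by move=> DD' [gc gd]; split=> // f fs; rewrite -DD'//; exact: gd.
Qed.

Lemma has_velocity_icoord c (p : R -> 'rV[R]_n) t dp : atlas c ->
  (coord c @` dom c) (p t) -> is_derive t (1 : R) p dp ->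
  has_velocity (icoord c \o p) t (fun f => 'D_dp (f \o icoord c) (p t)).
Proof.
move=> ac cp pd; split.
  apply: continuous_comp; last exact: icoord_continuous.
  apply: differentiable_continuous; apply/derivable1_diffP.
  by case: pd.
move=> f fs; have fd : differentiable (f \o icoord c) (p t).
  apply: smooth_at_differentiable.
  by have := fs c ac (icoord_dom cp); rewrite /= icoordK.
by rewrite deriveE//; exact: (is_derive_comp pd fd).
Qed.

Lemma has_velocity_coord gamma t D c : atlas c -> dom c (gamma t) ->
  has_velocity gamma t D ->
  is_derive t (1 : R) (coord c \o gamma)
    (\row_i D (fun y => coord c y ord0 i)).
Proof.
move=> ac cg [gc gd]; apply: is_derive_row => i; rewrite mxE.
by apply: gd; exact: smooth_fun_coord.
Qed.

(** The Leibniz rule.  In charts c and d the function f (gamma s * kappa s) is a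
    differentiable function Phi of the pair of coordinates of gamma s and
    kappa s, packed as a single row vector; its differential at that point is
    the sum of its restrictions to the two blocks, which are identified with D
    and D' by keeping the other factor constant. *)
Lemma has_velocityM gamma kappa t D D' :
  has_velocity gamma t D -> has_velocity kappa t D' ->
  has_velocity (fun s => gamma s * kappa s)%g t
    (fun f => D (fun x => f (x * kappa t)%g) + D' (fun y => f (gamma t * y)%g)).
Proof.
move=> gD kD; have [gc gd] := gD; have [kc kd] := kD; split.
  exact: (cvg_comp2 gc kc (mulg_continuous (_, _))).
move=> f fs; have [c ac cg] := atlas_cover (gamma t).
have [d ad dk] := atlas_cover (kappa t).
pose iota (r : 'rV[R]_(n + n)) := (lsubmx r, rsubmx r).
pose Phi (p : 'rV[R]_n * 'rV[R]_n) := f (icoord c p.1 * icoord d p.2)%g.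
pose r s : 'rV[R]_(n + n) := row_mx (coord c (gamma s)) (coord d (kappa s)).
have dPhi : differentiable (Phi \o iota) (r t).
  apply: smooth_at_differentiable.
  apply: (@smooth_at_precomp_affine _ _ _ _ _ _ iota).
  - move=> p; apply: differentiable_continuous.
    by apply: differentiable_pair; [exact: differentiable_lsubmx|exact: differentiable_rsubmx].
  - by move=> h v x; rewrite /iota !linearP.
  - by rewrite /iota /r row_mxKl row_mxKr; exact: smooth_fun_mul.
have dc := has_velocity_coord ac cg gD; have dd := has_velocity_coord ad dk kD.
set dp := (\row_i _) in dc; set dq := (\row_i _) in dd.
have drow (u v : R -> 'rV[R]_n) du dv : is_derive t (1 : R) u du -> is_derive t (1 : R) v dv ->
    is_derive t (1 : R) (fun s => row_mx (u s) (v s)) (row_mx du dv).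
  move=> ud vd; apply: is_derive_row => i.
  have [j ->|j ->] := split_ordP i.
    rewrite row_mxEl (_ : (fun y => _) = (fun y => u y ord0 j)); first exact: is_derive_coord.
    by apply/funext => y; rewrite row_mxEl.
  rewrite row_mxEr (_ : (fun y => _) = (fun y => v y ord0 j)); first exact: is_derive_coord.
  by apply/funext => y; rewrite row_mxEr.
have near_c : \forall s \near t, dom c (gamma s).
  by apply: gc; apply: open_nbhs_nbhs; split=> //; exact: dom_open.
have near_d : \forall s \near t, dom d (kappa s).
  by apply: kc; apply: open_nbhs_nbhs; split=> //; exact: dom_open.
have H : is_derive t (1 : R) (f \o (fun s => gamma s * kappa s)%g)
    ('d (Phi \o iota) (r t) (row_mx dp dq)).
  apply: near_eq_is_derive (is_derive_comp (drow _ _ _ _ dc dd) dPhi).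
  apply: filterS2 near_c near_d => s cs ds /=.
  by rewrite /Phi /iota /= row_mxKl row_mxKr !coordK.
have Hg : 'd (Phi \o iota) (r t) (row_mx dp 0) = D (fun x => f (x * kappa t)%g).
  have [_ <-] := gd _ (smooth_fun_mulr fs).
  apply/esym; apply: derive_val.
  apply: near_eq_is_derive (is_derive_comp (drow _ _ _ _ dc (is_derive_cst (coord d (kappa t)) t 1)) dPhi).
  apply: filterS near_c => s cs /=.
  by rewrite /Phi /iota /= row_mxKl row_mxKr !coordK.
have Hk : 'd (Phi \o iota) (r t) (row_mx 0 dq) = D' (fun y => f (gamma t * y)%g).
  have [_ <-] := kd _ (smooth_fun_mull fs).
  apply/esym; apply: derive_val.
  apply: near_eq_is_derive (is_derive_comp (drow _ _ _ _ (is_derive_cst (coord c (gamma t)) t 1) dd) dPhi).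
  apply: filterS near_d => s cs /=.
  by rewrite /Phi /iota /= row_mxKl row_mxKr !coordK.
by rewrite -Hg -Hk -linearD add_row_mx addr0 add0r.
Qed.

Lemma has_velocityV gamma t D : has_velocity gamma t D ->
  has_velocity (fun s => (gamma s)^-1)%g t (fun f => D (fun x => f (x^-1)%g)).
Proof.
move=> [gc gd]; split; first exact: (cvg_comp _ _ gc (invg_continuous _)).
by move=> f fs; apply: (gd (fun x => f (x^-1)%g)); exact: smooth_fun_inv.
Qed.

Lemma has_velocity_cst (x : G) t : has_velocity (fun=> x) t (fun=> 0).
Proof. by split=> [|f _]; [exact: cvg_cst|exact: is_derive_cst]. Qed.

Lemma has_velocity_affine gamma t (a b : R) D :
  has_velocity gamma (a * t + b) D ->
  has_velocity (fun s => gamma (a * s + b)) t (fun f => a * D f).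
Proof.
move=> [gc gd].
split.
  apply: (@continuous_comp _ _ _ (fun s => a * s + b) gamma) => //.
  apply: differentiable_continuous; apply/derivable1_diffP.
  by case: (is_derive_affine_map a b t).
by move=> f fs; apply: (is_derive_affine (f := f \o gamma)); exact: gd.
Qed.

End Velocity.

(** * Local solutions of ordinary differential equations *)

Section Picard.
Context {R : realType}.

Lemma small_geometric (c e : R) : 0 <= c -> 0 < e -> exists N, c * 2^-1 ^+ N < e.
Proof.
move=> c0 e0; have : `|2^-1 : R| < 1 by rewrite ger0_norm//; lra.
move=> /(@cvg_geometric R c)/cvgrPdist_lt/(_ _ e0)[N _ HN].
exists N; have := HN N (leqnn N); rewrite /= sub0r normrN ger0_norm//.
by rewrite mulr_ge0 ?exprn_ge0.
Qed.

Lemma fast_cauchy (u : nat -> R) (c : R) :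
  (forall k, `|u k.+1 - u k| <= c * 2^-1 ^+ k) ->
  exists l, forall k, `|l - u k| <= 2 * c * 2^-1 ^+ k.
Proof.
move=> uc; have c0 : 0 <= c.
  by apply: le_trans (normr_ge0 (u 1%N - u 0%N)) _; have := uc 0%N; rewrite expr0 mulr1.
have H k m : `|u (k + m)%N - u k| <= 2 * c * 2^-1 ^+ k - 2 * c * 2^-1 ^+ (k + m).
  elim: m => [|m IH]; first by rewrite addn0 !subrr normr0.
  rewrite addnS -(subrKA (u (k + m)%N)) (le_trans (ler_normD _ _))//.
  move: (uc (k + m)%N) IH; rewrite exprS; lra.
have H2 k m : (k <= m)%N -> `|u m - u k| <= 2 * c * 2^-1 ^+ k.
  move=> km; have := H k (m - k)%N; rewrite subnKC// => /le_trans; apply.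
  by rewrite gerBl mulr_ge0 ?exprn_ge0// mulr_ge0.
have : cvg (u @ \oo).
  apply: cauchy_cvg; apply: cauchy_exP => e e0.
  have [|N Ne] := @small_geometric (2 * c) e _ e0; first by rewrite mulr_ge0.
   exists (u N); exists N => // m /= Nm.
  by rewrite /ball/= distrC (le_lt_trans (H2 N m Nm)).
move=> /cvg_ex[l ul]; exists l => k; apply/ler_addgt0Pr => e e0.
move/cvgrPdist_lt : ul => /(_ _ e0)[N _ HN].
have := HN (maxn N k) (leq_maxl _ _); have := H2 k (maxn N k) (leq_maxr _ _).
move=> h1 h2; rewrite -(subrKA (u (maxn N k))) (le_trans (ler_normD _ _))//.
by rewrite addrC lerD// ltW.
Qed.

(** The integral starts at -1, so that the derivative is the two-sided one at every
    t > -1, in particular around 0; the second term normalizes the value at 0. *)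
Definition primitive (f : R -> R) (t : R) : R :=
  (\int[lebesgue_measure]_(s in `[-1, t]) f s)%R - (\int[lebesgue_measure]_(s in `[-1, 0%R]) f s)%R.

Lemma primitive0 f : primitive f 0 = 0.
Proof. exact: subrr. Qed.

Lemma is_derive_primitive (f : R -> R) (t : R) : continuous f -> -1 < t ->
  is_derive t (1 : R) (primitive f) (f t).
Proof.
move=> fc t1.
have [] := @continuous_FTC1_closed R f (-1) t (t + 1) _ _ t1 (fc t).
- by rewrite ltrDl.
- apply: continuous_compact_integrable; first exact: segment_compact.
  by apply: continuous_subspaceT => x; exact: fc.
set g := (fun x => _) => gd gE; rewrite /primitive.
have -> : f t = f t - 0 by rewrite subr0.
apply: (@is_deriveB _ _ _ g (cst _)).
by split=> //; rewrite -derive1E.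
Qed.

(** Clamping time to [-d, d] keeps the Picard iterates defined, continuous and
    within B on the whole line, so that sup estimates need no domain. *)
Definition clamp (d t : R) : R := Num.max (- d) (Num.min d t).

Lemma clamp_itv d t : 0 <= d -> - d <= clamp d t <= d.
Proof.
move=> ?; rewrite /clamp; case: (leP d t) => ?.
  by case: (leP (- d) d) => ?; apply/andP; split; lra.
by case: (leP (- d) t) => ?; apply/andP; split; lra.
Qed.

Lemma clampE d t : - d <= t <= d -> clamp d t = t.
Proof.
move=> /andP[? ?]; rewrite /clamp; case: (leP d t) => ?.
  by case: (leP (- d) d) => ?; lra.
by case: (leP (- d) t) => ?; lra.
Qed.

Lemma clamp_lip d s t : 0 <= d -> `|clamp d s - clamp d t| <= `|s - t|.
Proof.
move=> d0; have := ler_norm (s - t); have := ler_norm (t - s); rewrite (distrC t).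
have H u : [\/ u <= - d /\ clamp d u = - d, - d <= u <= d /\ clamp d u = u |
               d <= u /\ clamp d u = d].
  rewrite /clamp; case: (leP d u) => du.
    by apply: Or33; rewrite max_r//; lra.
  case: (leP (- d) u) => du'; first by apply: Or32; split=> //; rewrite ltW.
  by apply: Or31; rewrite ltW.
by rewrite ler_norml; case: (H s) => -[? ->]; case: (H t) => -[? ->] => ? ?;
  apply/andP; split; lra.
Qed.

Section Iteration.
Context {n : nat} (F : 'rV[R]_n -> 'rV[R]_n) (x0 : 'rV[R]_n) (r K L d : R).
Hypotheses (r0 : 0 < r) (d0 : 0 < d) (d1 : d < 1) (K0 : 0 <= K) (dK : d * K <= r) (dL : d * L <= 2^-1).
Let B := [set x : 'rV[R]_n | `|x - x0| <= r].
Hypothesis FK : forall x, B x -> `|F x| <= K.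
Hypothesis FL : forall x y, B x -> B y -> `|F x - F y| <= L * `|x - y|.
Hypothesis L0 : 0 <= L.

(* The iterates satisfy good, and T is the Picard operator. *)
Let good (p : R -> 'rV[R]_n) := continuous p /\ forall t, B (p t).

Let T (p : R -> 'rV[R]_n) (t : R) : 'rV[R]_n :=
  x0 + \row_j primitive (fun s => F (p s) ord0 j) (clamp d t).

Let Fc p j : good p -> continuous (fun s => F (p s) ord0 j).
Proof.
move=> [pc pB] s; apply/cvgrPdist_le => e e0.
have e1 : 0 < e / (L + 1) by rewrite divr_gt0// ltr_wpDl.
have /cvgrPdist_le/(_ _ e1) := pc s.
apply: filterS => t ht.
have := normr_row_le (F (p s) - F (p t)) j; rewrite !mxE => /le_trans; apply.
apply: (le_trans (FL (pB _) (pB _))).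
rewrite (le_trans (ler_wpM2l L0 ht))// mulrCA ler_piMr ?(ltW e0)//.
by rewrite ler_pdivrMr ?mul1r ?lerDl// ltr_wpDl.
Qed.

Let prim_d p j (t : R) : good p -> - d <= t <= d ->
  is_derive t (1 : R) (primitive (fun s => F (p s) ord0 j)) (F (p t) ord0 j).
Proof.
move=> gp td; apply: is_derive_primitive; [exact: Fc|case/andP: td => td _].
by apply: lt_le_trans td; rewrite ltrN2.
Qed.

Let mvi_d (f g : R -> R) (M t : R) :
  (forall s : R, - d <= s <= d -> is_derive s (1 : R) f (g s) /\ `|g s| <= M) ->
  - d <= t <= d -> f 0 = 0 -> `|f t| <= d * M.
Proof.
move=> fg td f0.
have M0 : 0 <= M by apply: le_trans (fg 0 _).2 => //; apply/andP; split; lra.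
have := @mean_value_ineq R f 0 t M; rewrite f0 !subr0 => H.
apply: le_trans (H _) _; last by rewrite mulrC ler_wpM2r// ler_norml.
move=> s hs; have [|[? sE] sM] := fg s; last by split=> //; rewrite sE.
by move: hs td; case: (leP 0 t) => _ /andP[? ?] /andP[? ?]; apply/andP; split; lra.
Qed.

Let T_good p : good p -> good (T p).
Proof.
move=> gp; split=> t.
  have E : T p = cst x0 + (fun t => \row_j primitive (fun s => F (p s) ord0 j) (clamp d t)) by [].
  rewrite E; apply: continuousD; first exact: cvg_cst.
  apply/cvgrPdist_le => e e0.
  have : \forall s \near t, `|t - s| <= e / (K + 1).
    have e1 : 0 < e / (K + 1) by rewrite divr_gt0// ltr_wpDl.
    by have /cvgrPdist_le/(_ _ e1) := @cvg_id _ (nbhs t).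
  apply: filterS => s ts; apply: normr_row_le_bound; first exact: ltW.
  move=> j; rewrite !mxE.
  apply: (@le_trans _ _ (K * `|clamp d t - clamp d s|)).
    apply: mean_value_ineq => w hw.
    have wd : - d <= w <= d.
      move: hw (clamp_itv t (ltW d0)) (clamp_itv s (ltW d0)).
      case: (leP (clamp d s) (clamp d t)) => _ /andP[? ?] /andP[? ?] /andP[? ?];
        by apply/andP; split; lra.
    have [? wE] := prim_d j gp wd; split=> //; rewrite wE.
    by apply: le_trans (normr_row_le _ j) _; apply: FK; apply: gp.2.
  apply: (@le_trans _ _ (K * (e / (K + 1)))).
    by rewrite ler_wpM2l//; apply: le_trans ts; apply: clamp_lip; exact: ltW.
  rewrite mulrCA ler_piMr ?(ltW e0)//.
  by rewrite ler_pdivrMr ?mul1r ?lerDl// ltr_wpDl.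
rewrite /B /T /= addrC addKr.
apply: normr_row_le_bound; first exact: ltW.
move=> j; rewrite mxE; apply: le_trans dK.
apply: (@mvi_d _ (fun s => F (p s) ord0 j)).
- move=> s sd; split; first exact: prim_d.
  by apply: le_trans (normr_row_le _ j) _; apply: FK; apply: gp.2.
- by apply: clamp_itv; exact: ltW.
- exact: primitive0.
Qed.

(* Contraction by 1/2, from d * L <= 1/2. *)
Let T_contract p q c : good p -> good q -> (forall t, `|p t - q t| <= c) ->
  forall t, `|T p t - T q t| <= c / 2.
Proof.
move=> gp gq pq t.
have c0 : 0 <= c by apply: le_trans (pq 0).
rewrite /T opprD addrACA subrr add0r; apply: normr_row_le_bound.
  by rewrite divr_ge0.
move=> j; rewrite !mxE; apply: (@le_trans _ _ (d * (L * c))); last first.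
  by rewrite mulrA mulrC ler_wpM2l.
apply: (@mvi_d (primitive (fun s => F (p s) ord0 j) \- primitive (fun s => F (q s) ord0 j))
         (fun s => F (p s) ord0 j - F (q s) ord0 j)).
- move=> s sd; split; first by apply: is_deriveB; exact: prim_d.
  have := normr_row_le (F (p s) - F (q s)) j; rewrite !mxE => /le_trans; apply.
  apply: (le_trans (FL (gp.2 _) (gq.2 _))).
  by rewrite ler_wpM2l.
- by apply: clamp_itv; exact: ltW.
- by rewrite /= !primitive0 subrr.
Qed.

(** The Picard iterates converge uniformly at a geometric rate; their limit is a
    fixed point of T, and T p has derivative F (p t) at t as long as the clamp is
    inactive. *)
Lemma picard_solution : exists p : R -> 'rV[R]_n,
  p 0 = x0 /\ forall t, `|t| < d -> B (p t) /\ is_derive t (1 : R) p (F (p t)).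
Proof.
pose p k := iter k T (fun=> x0).
have gp k : good (p k).
  elim: k => [|k IH]; last exact: T_good.
  split=> [t|t]; first exact: cvg_cst.
  by rewrite /B/= subrr normr0 ltW.
have pk k t : `|p k.+1 t - p k t| <= r * 2^-1 ^+ k.
  elim: k t => [|k IH] t; first by rewrite expr0 mulr1; exact: (gp 1%N).2.
  rewrite exprSr mulrA.
  exact: (T_contract (gp k.+1) (gp k) IH).
have lim_ t : {l : 'rV[R]_n | forall k, `|l - p k t| <= 2 * r * 2^-1 ^+ k}.
  apply: cid.
  have H j : {l | forall k, `|l - p k t ord0 j| <= 2 * r * 2^-1 ^+ k}.
    apply: cid; apply: fast_cauchy => k.
    by have := normr_row_le (p k.+1 t - p k t) j; rewrite !mxE => /le_trans; apply.
  exists (\row_j sval (H j)) => k; apply: normr_row_le_bound.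
    by rewrite mulr_ge0 ?exprn_ge0// mulr_ge0// ltW.
  by move=> j; rewrite !mxE; exact: (svalP (H j)).
pose q t := sval (lim_ t).
have qp t k : `|q t - p k t| <= 2 * r * 2^-1 ^+ k by exact: (svalP (lim_ t)).
have gq : good q.
  split=> t.
    apply/cvgrPdist_le => e e0.
    have [||N HN] := @small_geometric (2 * r) (e / 3); rewrite ?mulr_ge0 ?divr_gt0 ?ltW//.
    have e3 : 0 < e / 3 by rewrite divr_gt0.
    have /cvgrPdist_le/(_ _ e3) := (gp N).1 t.
    apply: filterS => s ts.
    have -> : q t - q s = (q t - p N t) + ((p N t - p N s) - (q s - p N s)).
      by rewrite opprB !subrKA.
    apply: (le_trans (ler_normD _ _)); have := ler_normB (p N t - p N s) (q s - p N s).
    have := qp t N; have := qp s N; lra.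
  rewrite /B/=; apply/ler_addgt0Pr => e e0.
  have [|N HN] := @small_geometric (2 * r) e _ e0; first by rewrite mulr_ge0// ltW.
  have := (gp N).2 t; rewrite /B/= => h.
  have := ler_normD (q t - p N t) (p N t - x0); rewrite subrKA => /le_trans; apply.
  have := qp t N; lra.
have Tq t : T q t = q t.
  apply/eqP; rewrite -subr_eq0 -normr_le0; apply/ler_addgt0Pr => e e0; rewrite add0r.
  have [|N HN] := @small_geometric (2 * r) e _ e0; first by rewrite mulr_ge0// ltW.
  have h1 := T_contract gq (gp N) (fun t => qp t N) t.
  have h2 := qp t N.+1; rewrite exprS in h2.
  have := ler_normD (T q t - p N.+1 t) (p N.+1 t - q t); rewrite subrKA => /le_trans; apply.
  rewrite (distrC _ (q t)); move: h1; rewrite -/(p N.+1); lra.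
exists q; split.
  rewrite -Tq /T (clampE (t := 0)) ?oppr_le0 ?ltW//.
  by apply/rowP => j; rewrite !mxE primitive0 addr0.
move=> t td; split; first exact: gq.2.
apply: is_derive_row => j.
have tdd : - d <= t <= d by rewrite -ler_norml ltW.
have := is_deriveD (is_derive_cst (x0 ord0 j) t (1 : R)) (prim_d j gq tdd).
rewrite add0r; apply: near_eq_is_derive.
have : \forall s \near t, `|s| < d.
  by have /(_ t) := @norm_continuous R R^o; move/cvgr_lt; apply.
apply: filterS => s sd /=.
by rewrite -[in RHS]Tq !mxE clampE// -ler_norml ltW.
Qed.

End Iteration.

End Picard.

(** A C^1 field is Lipschitz and bounded on a small box around x0; d is then
    chosen so that d * K <= r (the solution stays in the box) and d * L <= 1/2
    (the Picard operator is a contraction). *)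
Lemma local_ode_solution {R : realType} {n : nat} (A : set 'rV[R]_n)
    (F : 'rV[R]_n -> 'rV[R]_n) (x0 : 'rV[R]_n) :
  open_nbhs x0 A -> Ck_on 1 A F ->
  exists2 d : R, 0 < d & exists p : R -> 'rV[R]_n,
    p 0 = x0 /\ forall t, `|t| < d -> A (p t) /\ is_derive t (1 : R) p (F (p t)).
Proof.
move=> [oA Ax] F1.
pose e (i : 'I_n) : 'rV[R]_n := delta_mx ord0 i.
have F1j j : Ck_on 1 A (fun x => F x ord0 j) by exact: Ck_on_coord.
pose Mx := \sum_(i < n) \sum_(j < n) `|'D_(e i) (fun x => F x ord0 j) x0|.
have Mxge i j : `|'D_(e i) (fun x => F x ord0 j) x0| <= Mx.
  rewrite /Mx (bigD1 i)//= (bigD1 j)//= -addrA lerDl addr_ge0 ?sumr_ge0//.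
  by move=> k _; rewrite sumr_ge0.
have Mx0 : 0 <= Mx by apply: sumr_ge0 => i _; exact: sumr_ge0.
have : \forall y \near x0, A y /\ forall ij : 'I_n * 'I_n,
    `|'D_(e ij.1) (fun x => F x ord0 ij.2) y| <= Mx + 1.
  apply: filterI; first exact: open_nbhs_nbhs.
  apply: (@filter_forall _ _ (fun ij y => `|'D_(e ij.1) (fun x => F x ord0 ij.2) y| <= Mx + 1) (nbhs x0)).
  move=> [i j]/=; have [_ [_ /(_ (e i))[c _]]] := F1j j.
  have /cvgrPdist_le/(_ _ ltr01) := c x0 Ax.
  apply: filterS => y hy.
  rewrite -[X in `|X|](subrK ('D_(e i) (fun x => F x ord0 j) x0)) addrC.
  by rewrite (le_trans (ler_normD _ _))// lerD// distrC.
move=> /nbhs_ballP[rr /= rr0 xr].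
have {}rr0 : (0 : R) < rr by [].
pose r := rr / 2.
have r0 : 0 < r by rewrite divr_gt0.
have Br x : `|x - x0| <= r -> ball x0 rr x.
  move=> h; rewrite -ball_normE/= distrC; apply: (le_lt_trans h).
  by rewrite /r; lra.
pose L := n%:R * (Mx + 1).
have L0 : 0 <= L by rewrite mulr_ge0// addr_ge0.
have FL x y : `|x - x0| <= r -> `|y - x0| <= r -> `|F x - F y| <= L * `|x - y|.
  move=> /Br xx /Br yy; apply: normr_row_le_bound; first by rewrite mulr_ge0.
  move=> j; rewrite !mxE.
  apply: (@box_lipschitz R n (fun x => F x ord0 j) x0 rr (Mx + 1)) => // i z /xr[Az zM].
  split; last exact: (zM (i, j)).
  by have [_ [d _]] := F1j j; exact: d.
pose K := `|F x0| + L * r.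
have K0 : 0 <= K by rewrite addr_ge0// mulr_ge0// ltW.
have FK x : `|x - x0| <= r -> `|F x| <= K.
  move=> xx; rewrite -(subrK (F x0) (F x)) addrC (le_trans (ler_normD _ _))// lerD//.
  by rewrite (le_trans (FL _ _ xx _)) ?subrr ?normr0 ?(ltW r0)// ler_wpM2l.
pose d := Num.min 2^-1 (Num.min (r / (K + 1)) (2^-1 / (L + 1))).
have d0 : 0 < d.
  by rewrite !lt_min !divr_gt0 ?invr_gt0//; lra.
have d1 : d < 1 by rewrite gt_min; apply/orP; left; lra.
have dK : d * K <= r.
  have : d <= r / (K + 1) by rewrite !ge_min lexx orbT.
  rewrite ler_pdivlMr; last lra.
  by apply: le_trans; rewrite ler_wpM2l ?lerDl// ltW.
have dL : d * L <= 2^-1.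
  have : d <= 2^-1 / (L + 1) by rewrite !ge_min lexx !orbT.
  rewrite ler_pdivlMr; last lra.
  by apply: le_trans; rewrite ler_wpM2l ?lerDl// ltW.
have [p [p0 pd]] := picard_solution r0 d0 d1 K0 dK dL FK FL L0.
exists d => //; exists p; split=> // t /pd[/Br/xr[? _] ?].
by split.
Qed.

(** * Integral curves of right invariant fields *)

Lemma is_derive_glue {R : realType} (f g h : R -> R) (t D : R) :
  is_derive t (1 : R) f D -> is_derive t (1 : R) g D -> f t = g t ->
  (\forall s \near t, h s = if s < t then g s else f s) ->
  is_derive t (1 : R) h D.
Proof.
move=> fD gD fg hE.
have quot_cvg (k : R -> R) : is_derive t (1 : R) k D ->
    (fun e : R => e^-1 *: ((k \o shift t) (e *: (1 : R)) - k t)) @ 0^' --> D.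
  by move=> [kd <-].
have ht : h t = f t by have /nbhs_singleton := hE; rewrite ltxx.
have hD : (fun e : R => e^-1 *: ((h \o shift t) (e *: (1 : R)) - h t)) @ 0^' --> D.
  apply/cvgrPdist_le => e e0.
  have /cvgrPdist_le/(_ _ e0) Hf := quot_cvg f fD.
  have /cvgrPdist_le/(_ _ e0) Hg := quot_cvg g gD.
  have Hh : \forall e \near (0 : R)^', h (e + t) = if e + t < t then g (e + t) else f (e + t).
    apply: nbhs_dnbhs; have : (e + t) @[e --> (0 : R)] --> t.
      rewrite -[X in _ --> X]add0r; apply: cvgD; [exact: cvg_id|exact: cvg_cst].
    by move=> H; exact: (H _ hE).
  apply: filterS3 Hf Hg Hh => x /= xf xg xh.
  rewrite [x *: 1]mulr1 in xf xg *; rewrite xh ht.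
  by case: ifP => _ //; rewrite fg.
by split; [apply/cvg_ex; exists D|exact: cvg_lim].
Qed.

Section IntegralCurves.
Context {R : realType} {n : nat} {G : lieGroupType R n}.
Implicit Types (X Y : (G -> R) -> (G -> R)) (f : G -> R) (gamma : R -> G).

Definition tangent_at X gamma t := has_velocity gamma t (fun f => X f (gamma t)).

(** At a junction only the two one-sided pieces are known; both are tangent to X
    there with the same base point, so their common velocity is that of the
    pasted curve. *)
Lemma tangent_at_glue X (alpha beta gamma : R -> G) (t : R) :
  tangent_at X alpha t -> tangent_at X beta t -> alpha t = beta t ->
  (\forall s \near t, gamma s = if s < t then beta s else alpha s) ->
  tangent_at X gamma t.
Proof.
move=> [ac aX] [bc bX] ab gE.
have gt : gamma t = alpha t by have /nbhs_singleton := gE; rewrite ltxx.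
split.
  move=> S; rewrite gt => St.
  have Sa := ac S St; rewrite ab in St; have Sb := bc S St.
  apply: (@filterS3 _ (nbhs t) _ _ _ _ _ _ gE Sa Sb) => s /= -> ? ?.
  by case: ifP.
move=> f; rewrite gt => fs; apply: is_derive_glue (aX f fs) _ _ _.
- by rewrite ab; apply: bX; rewrite -ab.
- by rewrite /= ab.
- by apply: filterS gE => s /= ->; case: ifP.
Qed.

Lemma near_tangent_at X gamma gamma' t :
  (\near t, gamma t = gamma' t) -> tangent_at X gamma t -> tangent_at X gamma' t.
Proof.
move=> gg' gX; rewrite /tangent_at -(nbhs_singleton gg').
exact: near_has_velocity gX.
Qed.

Lemma tangent_at_mulr X gamma t (g : G) : rinv_lie_algebra G X ->
  tangent_at X gamma t -> tangent_at X (fun s => gamma s * g)%g t.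
Proof.
move=> [_ Xr] gX; apply: eq_has_velocity (has_velocityM gX (has_velocity_cst g t)).
by move=> f _; rewrite addr0 Xr.
Qed.

Lemma tangent_at_shift X gamma (t b : R) :
  tangent_at X gamma (t + b) -> tangent_at X (fun s => gamma (s + b)) t.
Proof.
rewrite -{1}[t]mul1r => /has_velocity_affine.
rewrite /tangent_at mul1r => H.
have -> : (fun s => gamma (s + b)) = (fun s => gamma (1 * s + b)).
  by apply/funext => s; rewrite mul1r.
by apply: eq_has_velocity H => f _; rewrite mul1r.
Qed.

Lemma local_integral_curve X : vector_field X ->
  exists2 d : R, 0 < d & exists gamma,
    gamma 0 = 1%g /\ forall t, `|t| < d -> tangent_at X gamma t.
Proof.
move=> [_ Xc]; have [c ac c1] := atlas_cover (1%g : G).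
have [a asm aX] := Xc c ac.
have c1n : open_nbhs (coord c 1%g) (coord c @` dom c).
  by split; [exact: codom_open|exists 1%g].
have [d d0 [p [p0 pd]]] := local_ode_solution c1n (asm 1%N).
exists d => //; exists (icoord c \o p); split.
  by rewrite /= p0 coordK.
move=> t /pd[cp dp]; apply: eq_has_velocity (has_velocity_icoord ac cp dp).
move=> f fs /=; rewrite (aX f _ (icoord_dom cp))//.
by rewrite icoordK.
Qed.

Definition zpow (g : G) (k : int) : G :=
  match k with Posz i => (g ^+ i)%g | Negz i => ((g ^+ i.+1)^-1)%g end.

Lemma zpowD1 g (k : int) : zpow g (k + 1) = (g * zpow g k)%g.
Proof.
case: k => [k|[|k]].
- by rewrite -PoszD addn1 /= expgS.
- by rewrite /= expg1 mulgV.
- have -> : Negz k.+1 + 1 = Negz k by rewrite !NegzE -addn1 PoszD opprD subrK.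
  by rewrite /= (expgSr g k.+1) invgM mulVKg.
Qed.

(** A local integral curve g0 with g0 0 = 1 is followed for a time e; right
    multiplication by powers of g0 e turns the piece over [0, e] into pieces over
    the intervals [k e, (k + 1) e] for all integers k, consecutive ones having
    the same value at their common endpoint. *)
Lemma integral_curve_exists X : rinv_lie_algebra G X ->
  exists2 gamma, integral_curve X gamma & gamma 0 = 1%g.
Proof.
move=> Xr; have [d d0 [g0 [g00 g0X]]] := local_integral_curve Xr.1.
pose e := d / 2; have e0 : 0 < e by rewrite divr_gt0.
have ed : e < d by rewrite /e; lra.
pose c := zpow (g0 e).
pose piece (k : int) s := (g0 (s + (- (k%:~R * e))) * c k)%g.
pose fl (t : R) := Num.floor (t / e).
have flE t k : k%:~R * e <= t < k%:~R * e + e -> fl t = k.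
  move=> /andP[h1 h2]; apply: floor_def.
  rewrite ler_pdivlMr// ltr_pdivrMr// h1 /= intrD mulrDl mul1r.
  exact: h2.
have flP t : (fl t)%:~R * e <= t < (fl t)%:~R * e + e.
  have /andP[h1 h2] := floor_itv (t / e).
  rewrite ler_pdivlMr// in h1; rewrite ltr_pdivrMr// intrD mulrDl mul1r in h2.
  by apply/andP.
pose gamma t := piece (fl t) t.
have pieceX k t : `|t - k%:~R * e| < d -> tangent_at X (piece k) t.
  move=> td; apply: tangent_at_mulr => //.
  by apply: tangent_at_shift; exact: g0X.
have gX t : tangent_at X gamma t.
  have /andP[t1 t2] := flP t; set k := fl t in t1 t2.
  have Xk : tangent_at X (piece k) t.
    by apply: pieceX; rewrite ger0_norm ?subr_ge0//; lra.
  move: t1; rewrite le_eqVlt => /orP[/eqP kt|kt]; last first.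
    apply: near_tangent_at Xk.
    have : \forall s \near t, s \in `]k%:~R * e, k%:~R * e + e[.
      by apply: near_in_itvoo; rewrite in_itv/= kt.
    apply: (@filterS _ (nbhs t)) => s; rewrite in_itv /= => /andP[s1 s2].
    by rewrite /gamma (flE s k)// s2 ltW.
  have k1 : (k - 1)%:~R * e = k%:~R * e - e by rewrite intrB mulrBl mul1r.
  have Xk1 : tangent_at X (piece (k - 1)) t.
    by apply: pieceX; rewrite k1 kt ger0_norm; lra.
  apply: (tangent_at_glue Xk Xk1).
    rewrite /piece k1 kt subrr g00 mul1g.
    rewrite (_ : t + - (t - e) = e); last by lra.
    by rewrite -zpowD1 subrK.
  have : \forall s \near t, s \in `]t - e, t + e[.
    by apply: near_in_itvoo; rewrite in_itv/=; apply/andP; split; lra.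
  apply: (@filterS _ (nbhs t)) => s; rewrite in_itv /= => /andP[s1 s2].
  rewrite /gamma; case: ltP => st.
    by rewrite (flE s (k - 1))// k1 kt; apply/andP; split; lra.
  by rewrite (flE s k)// kt; apply/andP; split; lra.
exists gamma.
  by split=> [t|t f fs]; [exact: (gX t).1|exact: (gX t).2].
rewrite /gamma /piece (flE 0 0) ?mul0r ?lexx ?add0r ?e0//.
by rewrite oppr0 g00 /c /= expg0 mulg1.
Qed.

Lemma lie_expP X : rinv_lie_algebra G X ->
  exists gamma, [/\ integral_curve X gamma, gamma 0 = 1%g & gamma 1 = lie_exp X].
Proof.
move=> /integral_curve_exists[gamma gX g0].
rewrite /lie_exp; set S := [set g | _].
by have : S (xget 1%g S) by apply: xgetPex; exists (gamma 1); exists gamma.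
Qed.

Lemma rinv_lie_algebra_lin X Y (a : R) :
  rinv_lie_algebra G X -> rinv_lie_algebra G Y -> rinv_lie_algebra G (a *: X + Y).
Proof.
move=> [[X0 Xc] Xr] [[Y0 Yc] Yr]; split; last first.
  by move=> g f x; rewrite !fctE Xr Yr.
split=> [f x fx|c ac]; first by rewrite !fctE X0// Y0// scaler0 addr0.
have [b bs bX] := Xc c ac; have [b' bs' bY] := Yc c ac.
exists (a *: b + b').
  have oc : open (coord c @` dom c) := @codom_open _ _ _ c.
  by move=> k; apply: Ck_onD (bs' k) => //; apply: Ck_onZ (bs k).
move=> f x cx fs; rewrite !fctE bX// bY//.
have fd : differentiable (f \o icoord c) (coord c x).
  by apply: smooth_at_differentiable; exact: fs.
by rewrite !deriveE// linearP.
Qed.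

Lemma rinv_lie_algebra0 : rinv_lie_algebra G 0.
Proof.
split=> //; split=> // c ac; exists (fun=> 0).
  by move=> k; exact: Ck_on_cst.
by move=> f x _ _; rewrite derive0.
Qed.

Lemma rinv_lie_algebra_affine m (Z : 'I_m.+1 -> (G -> R) -> (G -> R)) (u : 'rV[R]_m) :
  (forall i, rinv_lie_algebra G (Z i)) -> rinv_lie_algebra G (affine_field Z u).
Proof.
move=> Zr; rewrite /affine_field addrC; elim/big_rec: _ => [|i X _ Xr].
  by rewrite add0r.
by rewrite -addrA; exact: rinv_lie_algebra_lin.
Qed.

(** The differential of the inversion at 1 is - id: along an integral curve eta of
    X through 1, the Leibniz rule applies to eta * eta^-1, which is constant. *)
Lemma rinv_field_inv X f : rinv_lie_algebra G X -> smooth_fun_at f 1%g ->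
  X (fun x => f (x^-1)%g) 1%g = - X f 1%g.
Proof.
move=> Xr fs; have [eta [ec eX] e0] := integral_curve_exists Xr.
have eXt : tangent_at X eta 0 by split; [exact: ec|exact: eX].
have H := has_velocityM eXt (has_velocityV eXt).
have ee : (fun s => eta s * (eta s)^-1)%g = fun=> 1%g.
  by apply/funext => s; rewrite mulgV.
rewrite ee in H; have [_ /(_ f fs)[_ H1]] := H.
have [_ /(_ f fs)[_ H2]] := has_velocity_cst (1%g : G) (0 : R).
move: H1; rewrite H2 e0 invg1.
under eq_fun do rewrite mulg1.
under [in X in _ + X]eq_fun do rewrite mul1g.
by move=> /eqP; rewrite eq_sym addrC addr_eq0 => /eqP.
Qed.

End IntegralCurves.

(** * Reachability *)

Section WithinContinuity.
Context {R : realType}.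

Lemma within_continuous_interior {T S : topologicalType} (A : set T) (f : T -> S) x :
  {within A, continuous f} -> nbhs x A -> {for x, continuous f}.
Proof.
move=> /subspace_continuousP fc Ax W fW.
have := fc x (nbhs_singleton Ax) W fW.
by apply: (@filterS2 _ (nbhs x) _ _ _ _ _ Ax) => y Ay; exact.
Qed.

Lemma within_continuous_shift {S : topologicalType} (f : R -> S) (b : R) (A B : set R) :
  (forall s, B s -> A (s + b)) -> {within A, continuous f} ->
  {within B, continuous (fun s => f (s + b))}.
Proof.
move=> BA /subspace_continuousP fc; apply/subspace_continuousP => s Bs W fW.
have := fc _ (BA s Bs) W fW; rewrite /within/= => H.
have sc : (r + b) @[r --> s] --> s + b.
  by apply: cvgD; [exact: cvg_id|exact: cvg_cst].
apply: (@filterS _ (nbhs s) _ _ _ _ (sc _ H)) => r /= Hr Br.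
by apply: Hr; exact: BA.
Qed.

End WithinContinuity.

Section AffineFields.
Context {R : realType} {n : nat} {G : lieGroupType R n} {m : nat}.
Implicit Types (X Y : 'I_m.+1 -> (G -> R) -> (G -> R)) (f : G -> R) (u : 'rV[R]_m).

Lemma affine_fieldE X u f x :
  affine_field X u f x = X ord0 f x + \sum_(j < m) u ord0 j * X (lift ord0 j) f x.
Proof. by rewrite /affine_field !fctE !fct_sumE. Qed.

Lemma affine_field_lin X Y u :
  affine_field (fun i => X i + dI (X i) + Y i) u =
  affine_field (fun i => X i + Y i) u + dI (affine_field X u).
Proof.
apply/funext => f; apply/funext => x.
rewrite [in RHS]fctE /dI /= !affine_fieldE.
have -> : \sum_(j < m) u ord0 j * (X (lift ord0 j) + dI (X (lift ord0 j)) + Y (lift ord0 j)) f x =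
  \sum_(j < m) u ord0 j * (X (lift ord0 j) + Y (lift ord0 j)) f x +
  \sum_(j < m) u ord0 j * X (lift ord0 j) (fun y => f y^-1%g) x^-1%g.
  by rewrite -big_split; apply: eq_bigr => j _ /=; rewrite !fctE -mulrDr; congr (_ * _); rewrite /dI addrAC.
rewrite !fctE !affine_fieldE !fctE.
by rewrite (addrAC (X ord0 f x)) [LHS]addrACA.
Qed.

End AffineFields.

Section RightInvariant.
Context {R : realType} {n : nat} {G : lieGroupType R n}.
Implicit Types (X Z : (G -> R) -> (G -> R)) (f : G -> R).

(** Both sides are, up to sign, the derivative of f (g * exp (tX) * k) at t = 0. *)
Lemma dI_mulr X f (g k : G) : rinv_lie_algebra G X -> smooth_fun_at f (g * k)%g ->
  dI X (fun y => f (y * k)%g) g = - X (fun y => f (g * y)%g) k.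
Proof.
move=> Xr fs; have [_ Xinv] := Xr.
pose F z := f (g * (z * k))%g.
have Fs : smooth_fun_at F 1%g.
  apply: (@smooth_fun_mulr _ _ _ (fun z => f (g * z)%g)).
  by rewrite mul1g; exact: smooth_fun_mull.
have -> : X (fun y => f (g * y)%g) k = X F 1%g.
  by rewrite -[in LHS](mul1g k) -Xinv.
rewrite -rinv_field_inv// /dI -[in LHS](mul1g (g^-1)%g) -Xinv.
congr (X _ _); apply/funext => y.
by rewrite /F invgM invgK mulgA.
Qed.

(** The left invariant part dI X of the velocity of gamma is compensated by the
    velocity X of kappa. *)
Lemma tangent_at_conj X Z (gamma kappa : R -> G) t :
  rinv_lie_algebra G X -> rinv_lie_algebra G Z ->
  tangent_at (Z + dI X) gamma t -> tangent_at X kappa t ->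
  tangent_at Z (fun s => gamma s * kappa s)%g t.
Proof.
move=> Xr Zr gZ kX; apply: eq_has_velocity (has_velocityM gZ kX) => f fs.
by rewrite !fctE dI_mulr// addrNK; have [_ ->] := Zr.
Qed.

End RightInvariant.

Section Reachability.
Context {R : realType} {n : nat} {G : lieGroupType R n} {m : nat}.
Variables (F : 'rV[R]_m -> (G -> R) -> (G -> R)) (U : set 'rV[R]_m).

Lemma reachable_mulr (g h k : G) : (forall u, rinv_lie_algebra G (F u)) ->
  reachable F U g h -> reachable F U (g * k)%g (h * k)%g.
Proof.
move=> Fr [T [s [u [gamma [T0 adm [gc gF] <- <-]]]]].
exists T, s, u, (fun t => gamma t * k)%g; split=> //; split.
  move=> t; have kc : {for t, continuous ((fun=> k) : subspace `[0, T] -> G)} by exact: cvg_cst.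
  exact: (cvg_comp2 (gc t) kc (mulg_continuous (_, _))).
move=> t f tT ts fs; have [_ Finv] := Fr (u t).
have := gF t (fun y => f (y * k)%g) tT ts (smooth_fun_mulr fs).
by rewrite Finv.
Qed.

(** Trajectories are concatenated, the junction time T1 being declared a
    switching time so that nothing is asked of the derivative there. *)
Lemma reachable_trans (g h k : G) :
  reachable F U g h -> reachable F U h k -> reachable F U g k.
Proof.
move=> [T1 [s1 [u1 [g1 [T10 [U1 adm1] [c1 d1] <- <-]]]]].
move=> [T2 [s2 [u2 [g2 [T20 [U2 adm2] [c2 d2] g20 <-]]]]].
exists (T1 + T2), (T1 :: s1 ++ [seq x + T1 | x <- s2]).
exists (fun t => if t <= T1 then u1 t else u2 (t - T1)).
pose g3 t := if t <= T1 then g1 t else g2 (t - T1).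
exists g3; split=> //.
- exact: addr_gt0.
- split=> [t /andP[t0 tT]|a b a0 ab bT nos].
    by case: leP => tT1; [apply: U1; rewrite t0|apply: U2; apply/andP; split; lra].
  have nos1 t : a <= t <= b -> t \notin s1.
    by move=> /nos; rewrite inE mem_cat !negb_or => /and3P[].
  have nos2 t : a - T1 <= t <= b - T1 -> t \notin s2.
    move=> /andP[ta tb]; have : a <= t + T1 <= b by apply/andP; split; lra.
    move=> /nos; rewrite inE mem_cat !negb_or => /and3P[_ _].
    by apply: contra => ts2; apply/mapP; exists t.
  have : ~~ (a <= T1 <= b).
    by apply/negP => /nos; rewrite inE eqxx.
  rewrite negb_and -!ltNge => /orP[aT|bT1].
    rewrite !leNgt aT (lt_le_trans aT ab) /=.
    by apply: adm2 => //; lra.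
  rewrite (ltW bT1) (le_trans ab (ltW bT1)).
  exact: adm1.
- split.
    have -> : [set` `[0, T1 + T2]] = [set` `[0, T1]] `|` [set` `[T1, T1 + T2]] :> set R.
      apply/seteqP; split=> t /=; rewrite !in_itv/=.
        move=> /andP[t0 tT]; case: (leP t T1) => tT1; first by left; rewrite t0.
        by right; rewrite tT ltW.
      by move=> [] /andP[? ?]; apply/andP; split; lra.
    apply: withinU_continuous; [exact: itv_closed|exact: itv_closed| |].
      apply: subspace_eq_continuous c1 => t; rewrite inE/= in_itv/= => /andP[_ tT].
      by rewrite /from_subspace /g3 tT.
    have c2' : {within [set` `[T1, T1 + T2]], continuous (fun t => g2 (t + - T1))}.
      apply: within_continuous_shift c2 => t /=; rewrite !in_itv/= => /andP[? ?].
      by apply/andP; split; lra.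
    apply: subspace_eq_continuous c2' => t; rewrite inE/= in_itv/= => /andP[T1t _].
    rewrite /from_subspace /g3; case: leP => // tT1.
    by have -> : t = T1 by [lra|]; rewrite subrr g20.
  move=> t f /andP[t0 tT]; rewrite inE mem_cat !negb_or => /and3P[tT1 ts1 ts2].
  move: tT1; rewrite neq_lt => /orP[tT1|tT1].
    rewrite /g3 (ltW tT1) => fs.
    have : is_derive t (1 : R) (f \o g1) (F (u1 t) f (g1 t)).
      by apply: d1 => //; rewrite t0.
    apply: near_eq_is_derive.
    have : \forall r \near t, r < T1 by exact: lt_nbhsl.
    by apply: (@filterS _ (nbhs t)) => r rT1 /=; rewrite ltW.
  rewrite /g3 leNgt tT1 /= => fs.
  have H : is_derive (1 * t + - T1) (1 : R) (f \o g2) (F (u2 (t - T1)) f (g2 (t - T1))).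
    rewrite mul1r; apply: d2 => //; first by apply/andP; split; lra.
    apply: contra ts2 => ts2; apply/mapP; exists (t - T1) => //; lra.
  have := is_derive_affine H; rewrite mul1r.
  apply: near_eq_is_derive.
  have : \forall r \near t, T1 < r by exact: lt_nbhsr.
  by apply: (@filterS _ (nbhs t)) => r rT1 /=; rewrite leNgt rT1 mul1r.
- by rewrite /g3 (ltW T10).
- rewrite /g3 leNgt ltrDl T20 /=.
  by rewrite addrAC subrr add0r.
Qed.

End Reachability.

Lemma ltn_count {T : eqType} (p q : pred T) (s : seq T) (x : T) :
  subpred p q -> x \in s -> q x -> ~~ p x -> (count p s < count q s)%N.
Proof.
move=> pq xs qx px; elim: s xs => //= y s IH; rewrite inE => /orP[/eqP <-|/IH H].
  by rewrite qx (negPf px) add0n add1n ltnS sub_count.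
by rewrite -addnS leq_add//; case: (boolP (p y)) => // /pq ->.
Qed.

Section MainArgument.
Context {R : realType} {n : nat} {G : lieGroupType R n} {m : nat}.
Variables (X Y : 'I_m.+1 -> (G -> R) -> (G -> R)) (U : set 'rV[R]_m).
Hypotheses (Xr : forall i, rinv_lie_algebra G (X i)) (Yr : forall i, rinv_lie_algebra G (Y i)).

Let SigmaI := affine_field (fun i => X i + Y i).
Let SigmaA := affine_field (fun i => X i + dI (X i) + Y i).
Let S := reachable SigmaI U 1%g.

Let SigmaI_rinv u : rinv_lie_algebra G (SigmaI u).
Proof.
apply: rinv_lie_algebra_affine => i.
by rewrite -[X i]scale1r; exact: rinv_lie_algebra_lin.
Qed.

(** The value of the control is read off at the midpoint because the control is
    only known to be constant on the open interval ]a, b[. *)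
Lemma constant_control_step T s u gamma a b : 
  admissible_control U T s u -> solution SigmaA T s u gamma ->
  0 <= a -> a < b -> b <= T -> (forall t, a < t < b -> t \notin s) ->
  let v := u ((a + b) / 2) in
  U v /\ reachable SigmaI U (gamma a * lie_exp ((a - b) *: affine_field X v))%g (gamma b).
Proof.
move=> [uU uc] [gc gd] a0 ab bT nos v.
have Uv : U v by apply: uU; apply/andP; split; lra.
split=> //.
have uv t : a < t < b -> u t = v.
  move=> /andP[at_ tb]; rewrite /v; set c := (a + b) / 2.
  have ac : a < c by rewrite /c; lra.
  have cb : c < b by rewrite /c; lra.
  have [tc|ct] := leP t c.
    apply: uc => //; [lra|lra|] => r /andP[? ?].
    by apply: nos; apply/andP; split; lra.
  apply/esym; apply: uc => //; [lra|lra|lra|] => r /andP[? ?].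
  by apply: nos; apply/andP; split; lra.
have Zr : rinv_lie_algebra G (affine_field X v) by exact: rinv_lie_algebra_affine.
have [zeta [[zc zd] z0 z1]] : exists zeta, [/\ integral_curve ((a - b) *: affine_field X v) zeta,
    zeta 0 = 1%g & zeta 1 = lie_exp ((a - b) *: affine_field X v)].
  apply: lie_expP; rewrite -[X in rinv_lie_algebra G X]addr0.
  apply: rinv_lie_algebra_lin => //; exact: rinv_lie_algebra0.
pose tau := b - a; have tau0 : 0 < tau by rewrite subr_gt0.
pose k := (a - b)^-1.
(* With k = -1 / tau, kappa runs zeta backwards over [0, tau]. *)
pose kappa t := zeta (k * t + 1).
have ktau : k * tau = -1.
  by rewrite /k /tau -[b - a]opprB mulrN mulVf// subr_eq0 lt_eqF.
have kc : continuous kappa.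
  move=> t; apply: (@continuous_comp _ _ _ (fun s => k * s + 1) zeta); last exact: zc.
  apply: differentiable_continuous; apply/derivable1_diffP.
  by case: (is_derive_affine_map k 1 t).
have kX t : tangent_at (affine_field X v) kappa t.
  have : tangent_at ((a - b) *: affine_field X v) zeta (k * t + 1).
    by split; [exact: zc|exact: zd].
  move=> /has_velocity_affine; apply: eq_has_velocity => f _.
  by rewrite !fctE /k mulKf// subr_eq0 lt_eqF.
exists tau, [::], (fun=> v), (fun t => gamma (t + a) * kappa t)%g; split=> //.
- split.
    have c1 : {within `[0, tau], continuous (fun t => gamma (t + a))}.
      apply: within_continuous_shift gc => t /=; rewrite !in_itv/= /tau => /andP[? ?].
      by apply/andP; split; lra.
    have c2 : {within `[0, tau], continuous kappa} by exact: continuous_subspaceT.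
    by move=> t; exact: (cvg_comp2 (c1 t) (c2 t) (mulg_continuous (_, _))).
  move=> t f /andP[t0 tt] _ fs.
  have tab : a < t + a < b by rewrite /tau in tt; apply/andP; split; lra.
  suff [_] : tangent_at (SigmaI v) (fun t => gamma (t + a) * kappa t)%g t by exact.
  apply: (@tangent_at_conj _ _ _ (affine_field X v)) => //.
  apply: tangent_at_shift; split.
    apply: (within_continuous_interior gc).
    have : \forall r \near (t + a), r \in `]a, b[ by apply: near_in_itvoo; rewrite in_itv.
    apply: (@filterS _ (nbhs (t + a))) => r /=; rewrite !in_itv/= => /andP[? ?].
    by apply/andP; split; lra.
  move=> h hs; have := gd (t + a) h; rewrite (uv _ tab) /SigmaA affine_field_lin; apply => //.
    by case/andP: tab => ? ?; apply/andP; split; lra.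
  exact: nos.
- by rewrite /kappa add0r mulr0 add0r z1.
- by rewrite /kappa ktau addNr z0 mulg1 subrK.
Qed.

Hypothesis exp_reach : forall u t, U u -> S (lie_exp (t *: affine_field X u)).

(** Induction on the number of switching times strictly between a and b: any such
    time x splits [a, b] into two intervals with fewer of them.  The starting
    point is allowed to be 1, which need not lie in S a priori. *)
Lemma affine_reachable_sub : reachable SigmaA U 1%g `<=` S.
Proof.
move=> _ [T [s [u [gamma [T0 adm sol g0 <-]]]]].
suff H (k : nat) (a b : R) : (count (fun x : R => (a < x < b)%R) s < k)%N -> 0 <= a -> a < b -> b <= T ->
    gamma a = 1%g \/ S (gamma a) -> S (gamma b).
  by apply: (H _ 0 T (ltnSn _)) => //; left.
elim: k a b => // k IH a b; rewrite ltnS => cnt a0 ab bT ga.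
have [/hasP[x xs /andP[ax xb]]|/hasPn nos] := boolP (has (fun x => a < x < b) s).
  have Sx : S (gamma x).
    apply: (IH a x) => //; last lra.
    apply: leq_trans cnt; apply: (ltn_count (x := x)) => //; rewrite ?ax ?xb ?ltxx//.
    by move=> y /andP[-> yx]; apply: lt_trans xb.
  apply: (IH x b) => //; [|lra|by right].
  apply: leq_trans cnt; apply: (ltn_count (x := x)) => //; rewrite ?ax ?xb ?ltxx//.
  by move=> y /andP[xy ->]; rewrite andbT; apply: lt_trans xy.
have [|Uv H] := constant_control_step adm sol a0 ab bT.
  by move=> t tab; apply/negP => /nos; rewrite tab.
apply: reachable_trans H.
have e := exp_reach (a - b) Uv.
case: ga => [->|Sa]; first by rewrite mul1g.
apply: reachable_trans e _.
set c := lie_exp _.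
by have := reachable_mulr c SigmaI_rinv Sa; rewrite mul1g.
Qed.

End MainArgument.

Unset Implicit Arguments.
Set Strict Implicit.

Theorem theorem3p5 (R : realType) (n m : nat) (G : lieGroupType R n)
    (G_connected : connected [set: G])
    (G_semisimple : semisimple_lie (rinv_lie_algebra G))
    (G_finite_center : finite_set [set z : G | forall g : G, (z * g = g * z)%g])
    (calX X Y : 'I_m.+1 -> (G -> R) -> (G -> R)) (U : set 'rV[R]_m)
    (calX_linear : forall i, linear_vector_field (calX i))
    (calX_comm : forall i j, bracket (calX i) (calX j) = 0)
    (X_rinv : forall i, rinv_lie_algebra G (X i))
    (calXE : forall i, calX i = X i + dI (X i))
    (X_comm : forall i j, bracket (X i) (X j) = 0)
    (Y_rinv : forall i, rinv_lie_algebra G (Y i))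
    (SigmaI_rank : rank_condition (affine_field (fun i => X i + Y i)) U)
    (SigmaA_controllable :
      controllable (affine_field (fun i => calX i + Y i)) U) :
  (forall (u : 'rV[R]_m) (t : R), U u ->
     reachable (affine_field (fun i => X i + Y i)) U 1%g
       (lie_exp (t *: affine_field X u)))
  <-> controllable (affine_field (fun i => X i + Y i)) U.
Proof.
split=> [exp_reach g|ctrl u t _]; last by rewrite ctrl.
have calXE' : calX = fun i => X i + dI (X i) by apply/funext.
rewrite calXE' in SigmaA_controllable.
apply/seteqP; split=> // h _.
have Sh : reachable (affine_field (fun i => X i + Y i)) U 1%g (h * g^-1)%g.
  apply: (affine_reachable_sub X_rinv Y_rinv exp_reach).
  by rewrite SigmaA_controllable.
have := reachable_mulr g _ Sh; rewrite mul1g mulgVK; apply => u.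
apply: rinv_lie_algebra_affine => i.
by rewrite -[X i]scale1r; exact: rinv_lie_algebra_lin.
Qed.
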